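(* There is a reflexive Banach space $X$ (and so numerical radius attaining operators on it are dense in $\mathcal{L}(X)$) which fails to have the BPBp-nu.
   Context: For a real or complex Banach space $X$ with dual $X^*$ and unit sphere $S_X$, $\mathcal{L}(X)$ is the space of bounded linear operators on $X$ with the operator norm, $\Pi(X)=\{(x,x^* )\in S_X\times S_{X^*} : x^*(x)=1\}$, and the numerical radius of $T\in\mathcal{L}(X)$ is $v(T)=\sup\{|x^*(Tx)| : (x,x^* )\in\Pi(X)\}$. An operator $T\in\mathcal{L}(X)$ attains its numerical radius if there is $(x_0,x_0^* )\in\Pi(X)$ with $v(T)=|x_0^*(Tx_0)|$. BPBp-nu (Bishop-Phelps-Bollobás property for numerical radius): for every $0<\varepsilon<1$ there exists $\eta(\varepsilon)>0$ such that whenever $T\in\mathcal{L}(X)$ and $(x,x^* )\in\Pi(X)$ satisfy $v(T)=1$ and $|x^*(Tx)|>1-\eta(\varepsilon)$, there exist $S\in\mathcal{L}(X)$ and $(y,y^* )\in\Pi(X)$ with $v(S)=|y^*(Sy)|=1$, $\|T-S\|<\varepsilon$, $\|x-y\|<\varepsilon$ and $\|x^*-y^*\|<\varepsilon$. *)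

(* Defs.v *)
From HB Require Import structures.
From mathcomp Require Import all_boot all_order all_algebra.
From mathcomp Require Import all_classical all_reals all_analysis.
From mathcomp Require Import complex.

Set Implicit Arguments.
Unset Strict Implicit.
Unset Printing Implicit Defensive.

Import Order.TTheory GRing.Theory Num.Theory.
Import numFieldNormedType.Exports.

Local Open Scope classical_set_scope.
Local Open Scope ring_scope.

(* Everything is stated over a generic scalar field K : numFieldType, so that
   the same definitions serve K = R (real) and K = R[i] (complex), R : realType.
   Norms then take values in K; over R[i] the order is the partial one in which
   0 <= z forces z to be real, so norms, epsilon and eta are real numbers. *)

Definition bounded_linear (K : numFieldType) (X Y : normedModType K) :
    {pred X -> Y} :=
  mem [set f : X -> Y | linear f /\
    exists M : K, forall x, `|f x| <= M * `|x|].

Record bop (K : numFieldType) (X Y : normedModType K) := BOp {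
  bop_fun :> X -> Y;
  bop_bounded_linear : bop_fun \in @bounded_linear K X Y }.

Notation "{ 'bop' X -> Y }" := (@bop _ X Y)
  (at level 0, X at level 98, Y at level 99, format "{ 'bop'  X  ->  Y }").

Section bop_lmodType.
Variables (K : numFieldType) (X Y : normedModType K).

HB.instance Definition _ := [isSub for @bop_fun K X Y].
HB.instance Definition _ := [Choice of {bop X -> Y} by <:].

Lemma bounded_linear_submod_closed : submod_closed (@bounded_linear K X Y).
Proof.
have zE x : (0 : X -> Y) x = 0 by [].
have lE a f g x : (a *: f + g : X -> Y) x = a *: f x + g x by [].
split=> [|a f g].
  rewrite inE; split=> [b x y|]; first by rewrite !zE scaler0 addr0.
  by exists 0 => x; rewrite zE normr0 mul0r.
rewrite !inE => -[lf [M Mf]] [lg [N Ng]]; split=> [b x y|].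
  rewrite !lE lf lg !scalerDr !scalerA (mulrC a b) -!addrA.
  by congr (_ + _); rewrite addrCA.
exists (`|a| * M + N) => x; rewrite lE mulrDl.
apply: le_trans (ler_normD _ _) _; apply: lerD; last exact: Ng.
by rewrite normrZ -mulrA ler_wpM2l.
Qed.

HB.instance Definition _ := GRing.isSubmodClosed.Build K (X -> Y)
  (@bounded_linear K X Y) bounded_linear_submod_closed.
HB.instance Definition _ := [SubChoice_isSubLmodule of {bop X -> Y} by <:].

Lemma bop_is_linear (f : {bop X -> Y}) : linear f.
Proof. by case: f => f /=; rewrite inE => -[]. Qed.

HB.instance Definition _ (f : {bop X -> Y}) :=
  GRing.isLinear.Build K X Y *:%R f (@bop_is_linear f).

End bop_lmodType.

Section numerical_radius.
Variable K : numFieldType.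

(* [supremum 0 A] is the least upper bound of A whenever A is nonempty and has
   one; for K = R or R[i] this holds of every nonempty bounded set of
   nonnegative elements, so the default value 0 only concerns the supremum over
   the empty set (the numerical radius on the zero space). *)
Definition opnorm (X Y : normedModType K) (f : {bop X -> Y}) : K :=
  supremum 0 [set `|f x| | x in [set x : X | `|x| <= 1]].

(* Surjectivity of the canonical embedding x |-> (f |-> f x) of X into its
   bidual, i.e. onto the linear forms on X^* that are bounded for opnorm. *)
Definition reflexive_space (X : normedModType K) : Prop :=
  forall F : {linear {bop X -> K^o} -> K^o},
    (exists M : K, forall f : {bop X -> K^o}, `|F f| <= M * opnorm f) ->
    exists x : X, forall f : {bop X -> K^o}, F f = f x.

(* Usually written Pi(X). *)
Definition states (X : normedModType K) : set (X * {bop X -> K^o}) :=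
  [set p : X * {bop X -> K^o} | [/\ `|p.1| = 1, opnorm p.2 = 1 & p.2 p.1 = 1]].

Definition numradius (X : normedModType K) (T : {bop X -> X}) : K :=
  supremum 0 [set `|p.2 (T p.1) : K| | p in @states X].

Definition attains_numradius (X : normedModType K) (T : {bop X -> X}) : Prop :=
  exists2 p, @states X p & numradius T = `|p.2 (T p.1) : K|.

Definition numradius_attaining_dense (X : normedModType K) : Prop :=
  forall (T : {bop X -> X}) (eps : K), 0 < eps ->
    exists2 S : {bop X -> X}, attains_numradius S & opnorm (T - S) < eps.

Definition BPBp_nu (X : normedModType K) : Prop :=
  forall eps : K, 0 < eps < 1 ->
  exists2 eta : K, 0 < eta &
  forall (T : {bop X -> X}) (x : X) (xs : {bop X -> K^o}),
    states (x, xs) -> numradius T = 1 -> 1 - eta < `|xs (T x) : K| ->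
  exists (S : {bop X -> X}) (y : X) (ys : {bop X -> K^o}),
    [/\ states (y, ys),
        numradius S = `|ys (S y) : K| /\ `|ys (S y) : K| = 1,
        opnorm (T - S) < eps,
        `|x - y| < eps &
        opnorm (xs - ys) < eps].

End numerical_radius.

(* Main.v *)
From HB Require Import structures.
Require Import Defs.
From mathcomp Require Import all_boot all_order all_algebra.
From mathcomp Require Import all_classical all_reals all_analysis.
From mathcomp Require Import complex zify ring lra.

Set Implicit Arguments.
Unset Strict Implicit.
Unset Printing Implicit Defensive.

Import Order.TTheory GRing.Theory Num.Theory.
Import numFieldNormedType.Exports.

Local Open Scope classical_set_scope.
Local Open Scope ring_scope.

(** The space is l2, over the reals or the complex numbers, with the norm
      |x| = max (|x|_2 / 4, |x|_w),   |x|_w = sum_i 2^-i |x_i|,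
    which is equivalent to the Hilbert norm.

    Failure of the Bishop-Phelps-Bollobas property [ell2_not_BPBp]. Around the
    midpoint of e_0 and 2 e_1 the norm is the weighted l1 norm |.|_w. The
    operator T = [spread n] maps e_0 to (1 - 2^-n) e_0 + e_n, maps 2 e_1 to
    (1 - 2^-n) e_0 - e_n, and kills the other basis vectors. It has numerical
    radius 1, and at the midpoint the n-th coordinates of the two images cancel
    at a cost of only 2^-n, so that the state at the midpoint almost attains the
    numerical radius. Suppose that S is close to T and that v(S) = 1 is attained
    at a state (y, y') with y close to the midpoint. Since the norm is |.|_w
    around y, the functional y' is bounded by |.|_w [norming_le_l1], and y splits
    into y_0 e_0 + y_1 e_1 and a rest in such a way that |y'(S y)| = 1 forces
    |S (y_0 e_0 + y_1 e_1)|_w >= |y_0| + |y_1| / 2. On the other hand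
    |S e_0|_w <= 1 and |S e_1|_w <= 1/2, because all the functionals dominated by
    |.|_w that attain their norm at e_j are available as states
    [l1_image_unit_vec]. So the triangle inequality for |.|_w is an equality,
    hence is one in every coordinate. This fails in the n-th coordinate, where
    S e_0 and 2 S e_1 are close to 1 and -1: the term |.|_2 of the norm makes
    coordinates uniformly continuous, although |.|_w hardly sees the n-th one.

    Reflexivity [ell2_reflexive]. A functional f is the norm limit of its
    truncations, because (f e_i)_i is square summable. So a bounded form F on the
    dual is determined by x_i = F (coordinate i), and x is square summable.

    Density of numerical radius attaining operators [reflexive_numradius_dense].
    In a reflexive space a Lindenstrauss iteration applies: T_(n+1) is T_n plus a
    small rank one operator built from a state (x_n, f_n) that almost attains
    v(T_n), along the direction x_n + t_n T_n x_n. The sizes of the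
    perturbations decrease so fast that f_k has to stay almost extremal at that
    direction for all k > n. Letting k tend to infinity along an ultrafilter, and
    then n, one gets weak limits f and x with |f x| = 1 and |f (S x)| >= v(S) for
    the limit operator S.

    Both scalar fields are handled at once through the record [scalars]. *)

(** * Scalar fields containing the reals *)

(** Over the complex numbers the order is partial, so estimates are carried out
    in R: [emb] embeds R, and [re] reads norms back as real numbers. The condition
    [re_eq_norm] is the strict convexity of the modulus at positive reals, and
    [bounded_ultralimit] is the compactness of closed balls. *)
Record scalars (R : realType) := Scalars {
  sc_field :> numFieldType;
  emb : {rmorphism R -> sc_field};
  re : {additive sc_field -> R};
  embK : cancel emb re;
  emb_ge0 : forall r, 0 <= r -> 0 <= emb r;
  ge0_emb : forall z, 0 <= z -> exists2 r, 0 <= r & z = emb r;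
  re_le_norm : forall z, re z <= re `|z|;
  re_eq_norm : forall z, re z = re `|z| -> z = `|z|;
  bounded_ultralimit : forall (T : Type) (U : set_system T) (u : T -> sc_field)
    (M : R), UltraFilter U -> U [set t | re `|u t| <= M] ->
    exists l, forall e, 0 < e -> U [set t | re `|u t - l| < e] }.

Arguments emb {R} s.
Arguments re {R} s.

Section magnitude.
Context {R : realType} {K : scalars R}.
Implicit Types (a b z : K) (r s : R).

Local Notation emb := (emb K).
Local Notation re := (re K).

Lemma emb_inj : injective emb.
Proof. exact: can_inj (@embK R K). Qed.

Lemma ler_emb r s : (emb r <= emb s) = (r <= s).
Proof.
apply/idP/idP => [|rs]; last first.
  by rewrite -subr_ge0 -rmorphB; apply: emb_ge0; rewrite subr_ge0.
rewrite -subr_ge0 -rmorphB => /ge0_emb[t t0 /emb_inj rst].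
by rewrite -subr_ge0 rst.
Qed.

Lemma ltr_emb r s : (emb r < emb s) = (r < s).
Proof. by rewrite !lt_def ler_emb (inj_eq emb_inj). Qed.

(** The norm as an element of R, where linear arithmetic is available. *)
Definition mag (V : normedZmodType K) (x : V) : R := re `|x|.

Section mag_normed.
Variable V : normedZmodType K.
Implicit Types x y : V.

Lemma magE x : `|x| = emb (mag x).
Proof.
by rewrite /mag; have [r _ ->] := ge0_emb (normr_ge0 x); rewrite embK.
Qed.

Lemma mag_ge0 x : 0 <= mag x.
Proof. by rewrite -ler_emb -magE rmorph0. Qed.

Lemma le_mag x r : (`|x| <= emb r) = (mag x <= r).
Proof. by rewrite magE ler_emb. Qed.

Lemma lt_mag x r : (`|x| < emb r) = (mag x < r).
Proof. by rewrite magE ltr_emb. Qed.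

Lemma magD x y : mag (x + y) <= mag x + mag y.
Proof. by rewrite -le_mag rmorphD -!magE ler_normD. Qed.

Lemma magN x : mag (- x) = mag x.
Proof. by rewrite /mag normrN. Qed.

Lemma magB x y : mag (x - y) <= mag x + mag y.
Proof. by rewrite -(magN y) magD. Qed.

Lemma mag_distC x y : mag (x - y) = mag (y - x).
Proof. by rewrite /mag distrC. Qed.

Lemma mag_tri y x (z : V) : mag (x - z) <= mag (x - y) + mag (y - z).
Proof. by rewrite (le_trans _ (magD _ _)) // addrA subrK. Qed.

Lemma magB_ge x y : mag x - mag y <= mag (x - y).
Proof. by rewrite lerBlDr (le_trans _ (magD _ _)) // subrK. Qed.

Lemma mag0 : mag (0 : V) = 0.
Proof. by rewrite /mag normr0 raddf0. Qed.

Lemma mag_eq0 x : (mag x == 0) = (x == 0).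
Proof.
by rewrite -[RHS]normr_eq0 magE -[LHS](inj_eq (@emb_inj)) rmorph0.
Qed.

Lemma mag_gt0 x : (0 < mag x) = (x != 0).
Proof. by rewrite lt_def mag_ge0 andbT mag_eq0. Qed.

End mag_normed.

Lemma mag_sum (V : normedZmodType K) I (s : seq I) (P : pred I) (F : I -> V) :
  mag (\sum_(i <- s | P i) F i) <= \sum_(i <- s | P i) mag (F i).
Proof.
elim/big_rec2: _ => [|i x y _ yx]; first by rewrite mag0.
by rewrite (le_trans (magD _ _)) // lerD2l.
Qed.

Lemma magM a b : mag (a * b) = mag a * mag b.
Proof. by apply: emb_inj; rewrite rmorphM -!magE normrM. Qed.

Lemma magZ (V : normedModType K) a (x : V) : mag (a *: x) = mag a * mag x.
Proof. by apply: emb_inj; rewrite rmorphM -!magE normrZ. Qed.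

Lemma mag_emb r : mag (emb r) = `|r|.
Proof.
have [r0|r0] := leP 0 r.
  by rewrite /mag ger0_norm ?emb_ge0 // embK ger0_norm.
rewrite -magN -rmorphN /mag ger0_norm ?embK; last by apply: emb_ge0; lra.
by rewrite ltr0_norm.
Qed.

Lemma mag_pemb r : 0 <= r -> mag (emb r) = r.
Proof. by move=> r0; rewrite mag_emb ger0_norm. Qed.

Lemma mag1 : mag (1 : K) = 1.
Proof. by rewrite -(rmorph1 emb) mag_pemb. Qed.

Lemma magV a : mag a^-1 = (mag a)^-1.
Proof. by apply: emb_inj; rewrite fmorphV -!magE normfV. Qed.

Lemma re_le_mag a : re a <= mag a.
Proof. exact: re_le_norm. Qed.

Lemma re_eq_mag a : re a = mag a -> a = emb (mag a).
Proof. by move/re_eq_norm; rewrite magE. Qed.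

(** Real parts add up to the largest possible value, so each is extremal. *)
Lemma add_emb_extremal a b r s : mag a <= r -> mag b <= s ->
  a + b = emb (r + s) -> a = emb r.
Proof.
move=> ar bs abE; have := congr1 re abE; rewrite raddfD embK => reE.
have reA := re_le_mag a; have reB := re_le_mag b.
have ra : mag a = r by lra.
by rewrite -ra; apply: re_eq_mag; lra.
Qed.

(** The value 1 at 0 makes the modulus of a phase always 1. *)
Definition phase a : K := if a == 0 then 1 else a / `|a|.

Lemma mag_phase a : mag (phase a) = 1.
Proof.
rewrite /phase; have [_|a0] := eqVneq a 0; first exact: mag1.
by rewrite /mag normf_div normr_id divff ?normr_eq0 // -(rmorph1 emb) embK.
Qed.

Lemma phase_neq0 a : phase a != 0.
Proof. by rewrite -mag_eq0 mag_phase oner_eq0. Qed.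

Lemma phaseE a : phase a * emb (mag a) = a.
Proof.
rewrite /phase -magE; have [->|a0] := eqVneq a 0; first by rewrite normr0 mulr0.
by rewrite divfK ?normr_eq0.
Qed.

Lemma phaseVE a : (phase a)^-1 * a = emb (mag a).
Proof. by rewrite -{2}(phaseE a) mulKf ?phase_neq0. Qed.

Lemma mag_phaseV a : mag (phase a)^-1 = 1.
Proof. by rewrite magV mag_phase invr1. Qed.

(** An upper bound in K of a nonempty set of nonnegative elements is itself
    nonnegative, hence real, so suprema may be computed in R. *)
Lemma supremum_emb (A : set R) : A !=set0 -> has_ubound A ->
  (forall r, A r -> 0 <= r) -> supremum 0 (emb @` A) = emb (sup A).
Proof.
move=> [a Aa] ubA A0; rewrite /supremum ifF; last first.
  by apply/negbTE/set0P; exists (emb a), a.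
have supA : supremums (emb @` A) (emb (sup A)).
  split=> [_ [r Ar <-]|z zA]; first by rewrite ler_emb; apply: ub_le_sup.
  have az : emb a <= z by apply: zA; exists a.
  have z0 : 0 <= z by apply: le_trans az; apply/emb_ge0/A0.
  have [s s0 zE] := ge0_emb z0.
  rewrite zE ler_emb; apply: ge_sup; first by exists a.
  by move=> r Ar; rewrite -ler_emb -zE; apply: zA; exists r.
case: xgetP => [y -> supy|/(_ _ supA)//].
exact: is_subset1_supremums supy supA.
Qed.

End magnitude.

(** * Operator norm and numerical radius as real numbers *)

Section operators.
Context {R : realType} {K : scalars R}.
Local Notation emb := (emb K).
Local Notation re := (re K).

Section mkbop.
Variables X Y : normedModType K.

Lemma bounded_linear_mem (f : X -> Y) (M : R) : linear f ->
  (forall x, mag (f x) <= M * mag x) -> f \in @bounded_linear K X Y.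
Proof.
move=> lf Mf; rewrite inE; split=> //; exists (emb M) => x.
by rewrite !magE -rmorphM ler_emb.
Qed.

Definition mkbop (f : X -> Y) (M : R) (lf : linear f)
  (Mf : forall x, mag (f x) <= M * mag x) : {bop X -> Y} :=
  BOp (bounded_linear_mem lf Mf).

Lemma bop_ext (f g : {bop X -> Y}) : f =1 g -> f = g.
Proof. by move=> fg; apply/val_inj/funext. Qed.

Lemma bopD (f : {bop X -> Y}) x y : f (x + y) = f x + f y.
Proof. exact: linearD. Qed.

Lemma bopB (f : {bop X -> Y}) x y : f (x - y) = f x - f y.
Proof. exact: linearB. Qed.

Lemma bopZ (f : {bop X -> Y}) (a : K) x : f (a *: x) = a *: f x.
Proof. exact: linearZ. Qed.

Lemma bop_bounded (f : {bop X -> Y}) :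
  exists2 M : R, 0 <= M & forall x, mag (f x) <= M * mag x.
Proof.
have := bop_bounded_linear f; rewrite inE => -[_ [M Mf]].
exists (mag M) => [|x]; first exact: mag_ge0.
rewrite -(@ler_emb R K) rmorphM -!magE; have := Mf x.
have [->|x0] := eqVneq x 0; first by rewrite linear0 !normr0 !mulr0.
move=> fM; apply: le_trans fM _; rewrite ler_wpM2r // ger0_norm //.
rewrite -(@pmulr_lge0 _ `|x|) ?normr_gt0 //.
exact: le_trans (normr_ge0 _) (Mf x).
Qed.

Definition ropnorm (f : {bop X -> Y}) : R := re (opnorm f).

Let ball1 (f : {bop X -> Y}) : set R :=
  [set mag (f x) | x in [set x : X | mag x <= 1]].

Let ball1_0 f : ball1 f !=set0.
Proof. by exists (mag (f 0)); exists 0; rewrite //= mag0. Qed.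

Let ball1_ub f : has_ubound (ball1 f).
Proof.
have [M M0 Mf] := bop_bounded f; exists M => _ [x x1 <-].
by rewrite (le_trans (Mf x)) // ler_piMr.
Qed.

Let opnorm_sup f : opnorm f = emb (sup (ball1 f)).
Proof.
rewrite -supremum_emb //; last by move=> _ [x _ <-]; exact: mag_ge0.
congr supremum; apply/seteqP; split=> [_ [x /= x1 <-]|_ [_ [x x1 <-] <-]].
  exists (mag (f x)); last by rewrite magE.
  by exists x => //=; rewrite -le_mag rmorph1.
by exists x => /=; [rewrite -(rmorph1 emb) le_mag | rewrite magE].
Qed.

Lemma opnormE f : opnorm f = emb (ropnorm f).
Proof. by rewrite /ropnorm opnorm_sup embK. Qed.

Lemma ropnorm_ge (f : {bop X -> Y}) x : mag (f x) <= ropnorm f * mag x.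
Proof.
have [->|x0] := eqVneq x 0; first by rewrite linear0 !mag0 mulr0.
have x_gt0 : 0 < mag x by rewrite mag_gt0.
rewrite -ler_pdivrMr // /ropnorm opnorm_sup embK; apply: ub_le_sup => //.
exists (emb (mag x)^-1 *: x) => /=.
  by rewrite magZ mag_pemb ?invr_ge0 ?mag_ge0 // mulVf ?gt_eqF.
by rewrite linearZ /= magZ mag_pemb ?invr_ge0 ?mag_ge0 // mulrC.
Qed.

Lemma ropnorm_le (f : {bop X -> Y}) M :
  (forall x, mag x <= 1 -> mag (f x) <= M) -> ropnorm f <= M.
Proof.
move=> Mf; rewrite /ropnorm opnorm_sup embK; apply: ge_sup => // _ [x x1 <-].
exact: Mf.
Qed.

Lemma ropnorm_leM (f : {bop X -> Y}) M : 0 <= M ->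
  (forall x, mag (f x) <= M * mag x) -> ropnorm f <= M.
Proof.
move=> M0 Mf; apply: ropnorm_le => x x1; rewrite (le_trans (Mf x)) //.
by rewrite ler_piMr.
Qed.

Lemma ropnorm_ge0 (f : {bop X -> Y}) : 0 <= ropnorm f.
Proof.
rewrite /ropnorm opnorm_sup embK; apply: le_trans (mag_ge0 (f 0)) _.
by apply: ub_le_sup => //; exists 0; rewrite //= mag0.
Qed.

Lemma ropnorm_ge_ball (f : {bop X -> Y}) M x : ropnorm f <= M -> 0 <= M ->
  mag (f x) <= M * mag x.
Proof.
move=> fM M0; apply: le_trans (ropnorm_ge f x) _.
by rewrite ler_wpM2r ?mag_ge0.
Qed.

Lemma ropnormN (f : {bop X -> Y}) : ropnorm (- f) = ropnorm f.
Proof.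
suff H g : ropnorm (- g) <= ropnorm g by apply/le_anti; rewrite H -{1}(opprK f) H.
by apply: ropnorm_leM (ropnorm_ge0 _) _ => x; rewrite magN; exact: ropnorm_ge.
Qed.

Lemma ropnormD (f g : {bop X -> Y}) : ropnorm (f + g) <= ropnorm f + ropnorm g.
Proof.
apply: ropnorm_leM; first by rewrite addr_ge0 ?ropnorm_ge0.
by move=> x; rewrite (le_trans (magD _ _)) // mulrDl lerD ?ropnorm_ge.
Qed.

End mkbop.

Lemma functionalZ (X : normedModType K) (f : {bop X -> K^o}) (a : K) x :
  f (a *: x) = a * f x :> K.
Proof. exact: linearZ. Qed.

Lemma rank1_linear (X Y : normedModType K) (f : {bop X -> K^o}) (v : Y) :
  linear (fun x => (f x : K) *: v).
Proof. by move=> a x y; rewrite linearP scalerDl scalerA. Qed.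

Lemma rank1_bounded (X Y : normedModType K) (f : {bop X -> K^o}) (v : Y) x :
  mag ((f x : K) *: v) <= ropnorm f * mag v * mag x.
Proof. by rewrite magZ mulrAC ler_wpM2r ?mag_ge0 // ropnorm_ge. Qed.

Definition rank1 (X Y : normedModType K) (f : {bop X -> K^o}) (v : Y) :=
  mkbop (rank1_linear f v) (rank1_bounded f v).

End operators.

Section numerical_radius.
Context {R : realType} {K : scalars R}.
Variable X : normedModType K.
Local Notation emb := (emb K).
Local Notation re := (re K).
Implicit Types (T S : {bop X -> X}) (f : {bop X -> K^o}) (x : X).

Lemma statesP x f : states (x, f) <-> [/\ mag x = 1, ropnorm f = 1 & f x = 1].
Proof.
split=> -[/= x1 f1 fx]; split=> //=.
- by apply: (@emb_inj _ K); rewrite -magE x1 rmorph1.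
- by apply: (@emb_inj _ K); rewrite -opnormE f1 rmorph1.
- by rewrite magE x1 rmorph1.
- by rewrite opnormE f1 rmorph1.
Qed.

Definition rnumradius T : R := re (numradius T).

Let vals T : set R := [set mag (p.2 (T p.1) : K) | p in @states K X].

Let vals_ub T : has_ubound (vals T).
Proof.
exists (ropnorm T) => _ [[x f] /statesP[/= x1 f1 _] <-].
apply: le_trans (ropnorm_ge f _) _; rewrite f1 mul1r.
by rewrite -[leRHS]mulr1 -x1 ropnorm_ge.
Qed.

Hypothesis X0 : @states K X !=set0.

Let vals0 T : vals T !=set0.
Proof. by have [p Xp] := X0; exists (mag (p.2 (T p.1) : K)), p. Qed.

Let numradius_sup T : numradius T = emb (sup (vals T)).
Proof.
rewrite -supremum_emb //; last by move=> _ [p _ <-]; exact: mag_ge0.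
congr supremum; apply/seteqP; split=> [_ [p Xp <-]|_ [_ [p Xp <-] <-]].
  by exists (mag (p.2 (T p.1) : K)); [exists p | rewrite -magE].
by exists p => //; rewrite magE.
Qed.

Lemma numradiusE T : numradius T = emb (rnumradius T).
Proof. by rewrite /rnumradius numradius_sup embK. Qed.

Lemma rnumradius_ge T x f : states (x, f) -> mag (f (T x) : K) <= rnumradius T.
Proof.
move=> xf; rewrite /rnumradius numradius_sup embK; apply: ub_le_sup => //.
by exists (x, f).
Qed.

Lemma rnumradius_le T c :
  (forall x f, states (x, f) -> mag (f (T x) : K) <= c) -> rnumradius T <= c.
Proof.
move=> Tc; rewrite /rnumradius numradius_sup embK; apply: ge_sup => //.
by move=> _ [[x f] xf <-]; exact: Tc.
Qed.

Lemma rnumradius_adherent T e : 0 < e ->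
  exists x f, states (x, f) /\ rnumradius T - e < mag (f (T x) : K).
Proof.
move=> e0; have /(sup_adherent e0)[_ [[x f] xf <-]] : has_sup (vals T) by split.
by rewrite /rnumradius numradius_sup embK => xfe; exists x, f.
Qed.

Lemma rnumradius_ge0 T : 0 <= rnumradius T.
Proof.
by have [[x f] /(rnumradius_ge T)] := X0; apply: le_trans; exact: mag_ge0.
Qed.

Lemma states_bound x f T : states (x, f) -> mag (f (T x) : K) <= ropnorm T.
Proof.
move=> /statesP[x1 f1 _]; rewrite (le_trans (ropnorm_ge f _)) // f1 mul1r.
by rewrite -[leRHS]mulr1 -x1 ropnorm_ge.
Qed.

Lemma rnumradius_lipschitz T S : rnumradius T <= rnumradius S + ropnorm (T - S).
Proof.
apply: rnumradius_le => x f xf.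
have -> : f (T x) = f (S x) + f ((T - S) x).
  by rewrite -linearD; congr (f _); rewrite /= addrC subrK.
by rewrite (le_trans (magD _ _)) // lerD ?rnumradius_ge // states_bound.
Qed.

(** The hypotheses force |x| = r and the norm of f to be 1 when r > 0, so
    that (x / r, f) is a state; no normalisation has to be carried out. *)
Lemma rnumradius_ge_scaled T x f r : ropnorm f <= 1 -> mag x <= r -> f x = emb r ->
  mag (f (T x) : K) <= rnumradius T * r.
Proof.
move=> f1 xr fx; have r0 : 0 <= r by apply: le_trans xr; exact: mag_ge0.
have [r_eq0|r_neq0] := eqVneq r 0.
  have /eqP : mag x = 0 by apply/le_anti; rewrite mag_ge0 andbT -r_eq0.
  by rewrite mag_eq0 => /eqP ->; rewrite !linear0 mag0 r_eq0 mulr0.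
have r_gt0 : 0 < r by rewrite lt_def r_neq0.
have fx_le : r <= ropnorm f * mag x by rewrite -(@mag_pemb R K r r0) -fx ropnorm_ge.
have {}xr : mag x = r.
  by apply/le_anti; rewrite xr (le_trans fx_le) // ler_piMl ?mag_ge0.
have {}f1 : ropnorm f = 1.
  by apply/le_anti; rewrite f1 -(ler_pM2r r_gt0) mul1r -{2}xr.
rewrite -ler_pdivrMr //; have := @rnumradius_ge T (emb r^-1 *: x) f.
rewrite !linearZ /= magM mag_pemb ?invr_ge0 // mulrC; apply.
apply/statesP; split=> //.
  by rewrite magZ mag_pemb ?invr_ge0 // xr mulVf.
by rewrite functionalZ fx -rmorphM mulVf // rmorph1.
Qed.

End numerical_radius.

(** * Limits along an ultrafilter *)

Section ultralimits.
Context {R : realType} {K : scalars R}.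
Local Notation emb := (emb K).
Variables (I : Type) (U : set_system I).
Hypothesis UU : UltraFilter U.
Implicit Types (u w : I -> K) (l m : K).

Definition ulim u l := forall e : R, 0 < e -> U [set i | mag (u i - l) < e].

Let UF : ProperFilter U. Proof. exact: ultra_proper. Qed.

Lemma ulim_ex u M : U [set i | mag (u i) <= M] -> exists l, ulim u l.
Proof. exact: bounded_ultralimit. Qed.

Lemma ulim_mag_le u l c : ulim u l -> (forall e : R, 0 < e -> U [set i | mag (u i) <= c + e]) ->
  mag l <= c.
Proof.
move=> ul uc; apply/ler_addgt0Pr => e e0.
have e20 : 0 < e / 2 by lra.
have [i [/= h1 h2]] := filter_ex (filterI (ul _ e20) (uc _ e20)).
have := magB_ge l (u i); rewrite mag_distC => h3; lra.
Qed.

Lemma ulim_mag_ge u l c : ulim u l -> (forall e : R, 0 < e -> U [set i | c - e <= mag (u i)]) ->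
  c <= mag l.
Proof.
move=> ul uc; apply/ler_addgt0Pr => e e0.
have e20 : 0 < e / 2 by lra.
have [i [/= h1 h2]] := filter_ex (filterI (ul _ e20) (uc _ e20)).
have := magB_ge (u i) l => h3; lra.
Qed.

Lemma ulim_uniq u l m : ulim u l -> ulim u m -> l = m.
Proof.
move=> ul um; apply/eqP; rewrite -subr_eq0 -mag_eq0; apply/eqP/le_anti.
rewrite mag_ge0 andbT; apply/ler_addgt0Pr => e e0; rewrite add0r.
have e20 : 0 < e / 2 by lra.
have [i [/= h1 h2]] := filter_ex (filterI (ul _ e20) (um _ e20)).
have := mag_tri (u i) l m; rewrite (mag_distC l (u i)) => h3; lra.
Qed.

Lemma ulim_lin a u w l m : ulim u l -> ulim w m ->
  ulim (fun i => a * u i + w i) (a * l + m).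
Proof.
move=> ul wm e e0; have a0 := mag_ge0 a.
have d0 : 0 < e / 2 / (mag a + 1) by rewrite !divr_gt0 //; lra.
have e20 : 0 < e / 2 by lra.
apply: filterS (filterI (ul _ d0) (wm _ e20)) => i [/= h1 h2].
have -> : a * u i + w i - (a * l + m) = a * (u i - l) + (w i - m) by ring.
apply: le_lt_trans (magD _ _) _; rewrite magM.
have : mag a * mag (u i - l) <= (mag a + 1) * (e / 2 / (mag a + 1)).
  by apply: ler_pM; rewrite ?mag_ge0 ?ltW // ltrDl.
rewrite [leRHS]mulrC divfK; last by rewrite gt_eqF //; lra.
lra.
Qed.

Section bounded_families.
Variable X : normedModType K.

(** Weak compactness of balls: f |-> lim_U (f (x_ i)) is a bounded linear form on
    the dual, which reflexivity represents by a point. *)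
Lemma weak_ulim (x_ : I -> X) (B : R) : reflexive_space X ->
  (forall i, mag (x_ i) <= B) ->
  exists x : X, forall f : {bop X -> K^o}, ulim (fun i => f (x_ i)) (f x).
Proof.
move=> Xr xB; have [i0 _] := filter_ex (@filterT _ U _).
have B0 : 0 <= B by apply: le_trans (xB i0); exact: mag_ge0.
have fB (f : {bop X -> K^o}) i : mag (f (x_ i)) <= ropnorm f * B.
  by rewrite (le_trans (ropnorm_ge f _)) // ler_wpM2l ?ropnorm_ge0.
have /choice[F FE] : forall f : {bop X -> K^o}, exists l : K^o,
    ulim (fun i => f (x_ i)) l.
  move=> f; apply: (@ulim_ex _ (ropnorm f * B)).
  by apply: filterS filterT => i _; exact: fB.
have lF : linear F.
  move=> a f g; apply: ulim_uniq (FE (a *: f + g)) _.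
  exact: ulim_lin (FE f) (FE g).
pose Flin : {linear {bop X -> K^o} -> K^o} :=
  HB.pack F (GRing.isLinear.Build K _ _ _ F lF).
have [|x Fx] := Xr Flin; last by exists x => f; rewrite -Fx.
exists (emb B) => f; rewrite opnormE -rmorphM le_mag mulrC.
apply: ulim_mag_le (FE f) _ => e e0.
by apply: filterS filterT => i _ /=; rewrite (le_trans (fB f i)) // lerDl ltW.
Qed.

Lemma weak_star_ulim (f_ : I -> {bop X -> K^o}) :
  (forall i, ropnorm (f_ i) <= 1) ->
  exists2 f : {bop X -> K^o}, ropnorm f <= 1 &
    forall x, ulim (fun i => f_ i x) (f x).
Proof.
move=> f1; have fB i x : mag (f_ i x) <= mag x.
  by rewrite -[leRHS]mul1r ropnorm_ge_ball.
have /choice[F FE] : forall x, exists l : K^o, ulim (fun i => f_ i x) l.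
  move=> x; apply: (@ulim_ex _ (mag x)).
  by apply: filterS filterT => i _; exact: fB.
have lF : linear F.
  move=> a x y; apply: ulim_uniq (FE (a *: x + y)) _.
  under [X in ulim X _]funext do rewrite linearP.
  exact: ulim_lin (FE x) (FE y).
have F1 x : mag (F x) <= 1 * mag x.
  apply: ulim_mag_le (FE x) _ => e e0; apply: filterS filterT => i _ /=.
  by rewrite mul1r (le_trans (fB i x)) // lerDl ltW.
by exists (mkbop lF F1) => //; apply: ropnorm_leM.
Qed.

End bounded_families.
End ultralimits.

(** The limit exists pointwise by completeness, and the bounds on the differences
    pass to the limit uniformly on balls. *)
Lemma bop_limit (R : realType) (K : scalars R) (X : normedModType K)
  (Y : completeNormedModType K) (T_ : nat -> {bop X -> Y}) (tau : nat -> R) :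
  (forall n k, (n <= k)%N -> ropnorm (T_ k - T_ n) <= tau n) ->
  (forall e : R, 0 < e -> exists n, tau n < e) ->
  exists S : {bop X -> Y}, forall n, ropnorm (S - T_ n) <= tau n.
Proof.
move=> Ttau tau0.
have tau_ge0 n : 0 <= tau n by apply: le_trans (Ttau n n (leqnn n)); exact: ropnorm_ge0.
have Tx n k x : (n <= k)%N -> mag (T_ k x - T_ n x) <= tau n * mag x.
  by move=> nk; apply: (ropnorm_ge_ball (f := T_ k - T_ n)) => //; exact: Ttau.
have small (x : X) (e : R) : 0 < e -> exists n, tau n * mag x < e.
  move=> e0; have x1 : 0 < mag x + 1 by rewrite ltr_wpDl ?mag_ge0.
  have [|n n_e] := tau0 (e / (mag x + 1)); first by rewrite divr_gt0.
  exists n; apply: le_lt_trans (_ : tau n * (mag x + 1) < e).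
    by rewrite ler_wpM2l // lerDl.
  by rewrite -ltr_pdivlMr.
have /choice[F FE] : forall x, exists y, forall n, mag (y - T_ n x) <= tau n * mag x.
  move=> x.
  have /cauchy_cvg/cvg_ex[y Ty] : cauchy ((fun n => T_ n x) @ \oo).
    apply: cauchy_exP => e e0.
    have [|n n_e] := small x (re K e).
      have [r r0 eE] := ge0_emb (ltW e0); move: e0.
      by rewrite eE embK -(rmorph0 (emb K)) ltr_emb.
    exists (T_ n x); exists n => // k /= nk.
    rewrite -ball_normE /=; have [r r0 eE] := ge0_emb (ltW e0).
    rewrite eE lt_mag mag_distC (le_lt_trans (Tx _ _ _ nk)) //.
    by rewrite eE embK in n_e.
  exists y => n; apply/ler_addgt0Pr => e e0.
  have /cvgrPdist_lt/(_ (emb K e)) := Ty.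
  rewrite -(rmorph0 (emb K)) ltr_emb => /(_ e0) [N _ NE].
  have := NE (maxn N n) (leq_maxl _ _); rewrite /= lt_mag => h1.
  have h2 := Tx n (maxn N n) x (leq_maxr _ _).
  have := mag_tri (T_ (maxn N n) x) y (T_ n x); lra.
have lF : linear F.
  move=> a x y; apply/eqP; rewrite -subr_eq0 -mag_eq0; apply/eqP/le_anti.
  rewrite mag_ge0 andbT; apply/ler_addgt0Pr => e e0; rewrite add0r.
  pose C := mag (a *: x + y) + mag a * mag x + mag y.
  have C1 : 0 < C + 1.
    by rewrite ltr_wpDl // !addr_ge0 ?mulr_ge0 ?mag_ge0.
  have [|n n_e] := tau0 (e / (C + 1)); first by rewrite divr_gt0.
  have -> : F (a *: x + y) - (a *: F x + F y) =
     (F (a *: x + y) - T_ n (a *: x + y)) - (a *: (F x - T_ n x)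
       + (F y - T_ n y)).
    by rewrite [T_ n (_ + _)]linearP scalerBr (addrACA (a *: F x)) -opprD opprB addrA subrK.
  apply: le_trans (magB _ _) _; apply: le_trans (lerD (FE _ n) (magD _ _)) _.
  rewrite magZ; have := ler_wpM2l (mag_ge0 a) (FE x n); have := FE y n.
  have : tau n * (C + 1) <= e by rewrite -ler_pdivlMr // ltW.
  rewrite /C => h1 h2 h3; have := tau_ge0 n; lra.
have bF x : mag (F x) <= (ropnorm (T_ 0%N) + tau 0%N) * mag x.
  have := FE x 0%N; have := ropnorm_ge (T_ 0%N) x; have := magB_ge (F x) (T_ 0%N x).
  lra.
exists (mkbop lF bF) => n; apply: ropnorm_leM => // x; exact: FE.
Qed.

(** * Density of numerical radius attaining operators *)

Section lindenstrauss.
Context {R : realType} {K : scalars R}.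
Variable X : completeNormedModType K.
Local Notation emb := (emb K).
Local Notation op := {bop X -> X}.
Local Notation fn := {bop X -> K^o}.

Hypothesis X0 : @states K X !=set0.
Variables (T0 : op) (tau0 : R).
Hypotheses (tau0_gt0 : 0 < tau0) (tau0_le1 : tau0 <= 1).

Let t n : R := (n.+2%:R)^-1.

(** [tau n] bounds the total size of the perturbations from step n on. As
    tau_(n+1) = t_n^2 tau_n, what follows step n is negligible with respect to
    t_n times the perturbation of step n. *)
Fixpoint tau n : R := if n is n'.+1 then tau n' * t n' ^+ 2 else tau0.

Let M : R := ropnorm T0 + 1.
Let B : R := 1 + M.
Let eps n : R := (tau n - tau n.+1) / B.

Let t_gt0 n : 0 < t n. Proof. by rewrite invr_gt0 ltr0n. Qed.

Let t_le n : t n <= 1 / 2.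
Proof. by rewrite div1r lef_pV2 ?posrE ?ltr0n // ler_nat. Qed.

Let t_decr n : t n <= 2 * t n.+1.
Proof.
rewrite -ler_pdivrMr // /t invrK mulrC ler_pdivrMr ?ltr0n //.
by rewrite -natrM ler_nat; lia.
Qed.

Let tau_gt0 n : 0 < tau n.
Proof. by elim: n => //= n IHn; rewrite mulr_gt0 ?exprn_gt0. Qed.

Let tauS n : tau n.+1 <= tau n / 4.
Proof.
have := t_le n; have := t_gt0 n; have := tau_gt0 n; rewrite /= => h1 h2 h3.
have : t n ^+ 2 <= 1 / 4 by nra.
by move=> h; rewrite -[_ / 4]/(_ * 4^-1) ler_wpM2l //; lra.
Qed.

Let tau_decr n k : (n <= k)%N -> tau k <= tau n.
Proof.
move/subnK <-; elim: (k - n)%N => // m IHm; rewrite addSn.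
by have := tauS (m + n); have := tau_gt0 (m + n); lra.
Qed.

Let tau_le1 n : tau n <= 1.
Proof. exact: le_trans (tau_decr (leq0n n)) tau0_le1. Qed.

Let tau_le_t n : tau n <= 2 * t n.
Proof.
case: n => [|n] /=; first by rewrite /t divff // pnatr_eq0.
have t0 := t_gt0 n; have t2 : t n ^+ 2 <= t n.
  by rewrite expr2 ler_piMl ?(ltW t0) // (le_trans (t_le n)) //; lra.
have : tau n * t n ^+ 2 <= t n ^+ 2 by rewrite ler_piMl // exprn_ge0 // ltW.
by have := t_decr n; lra.
Qed.

Let M_ge1 : 1 <= M. Proof. by rewrite lerDr ropnorm_ge0. Qed.

Let B_ge2 : 2 <= B. Proof. by have := M_ge1; rewrite /B; lra. Qed.

Let eps_gt0 n : 0 < eps n.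
Proof.
rewrite divr_gt0 //; last by have := B_ge2; lra.
by have := tauS n; have := tau_gt0 n; lra.
Qed.

Let epsE n : eps n * B = tau n - tau n.+1.
Proof. by rewrite /eps divfK // gt_eqF // (lt_le_trans _ B_ge2). Qed.

(** The phase makes f (push n T x f) as large as the two parts allow, when
    f x = 1. In the limit the part along x yields |f x| = 1, since t_n tends to 0,
    and the part along T x yields the size of f (S x). *)
Definition push n (T : op) (x : X) (f : fn) : X :=
  phase (f (T x) : K) *: x + emb (t n) *: T x.

Let near_max n (T : op) : exists p : X * fn,
  states p /\ rnumradius T - tau n.+1 < mag (p.2 (T p.1) : K).
Proof.
by have [x [f ?]] := rnumradius_adherent X0 T (tau_gt0 n.+1); exists (x, f).
Qed.

Let choose_state n T : X * fn := projT1 (cid (near_max n T)).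

Fixpoint iterate n : op := if n is n'.+1 then
  let T := iterate n' in let p := choose_state n' T in
  T + emb (eps n') *: rank1 p.2 (push n' T p.1 p.2) else T0.

Let x_ n := (choose_state n (iterate n)).1.
Let f_ n := (choose_state n (iterate n)).2.
Let v_ n := push n (iterate n) (x_ n) (f_ n).

Let states_n n : states (x_ n, f_ n).
Proof.
by rewrite /x_ /f_ /choose_state; case: cid => -[x f] /= [].
Qed.

Let near_max_n n :
  rnumradius (iterate n) - tau n.+1 < mag (f_ n (iterate n (x_ n)) : K).
Proof.
by rewrite /x_ /f_ /choose_state; case: cid => -[x f] /= [].
Qed.

Let iterateS n z :
  iterate n.+1 z = iterate n z + (emb (eps n) * f_ n z) *: v_ n.
Proof. by rewrite -scalerA. Qed.

Let mag_push n : ropnorm (iterate n) <= M -> mag (v_ n) <= B.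
Proof.
move=> TM; have /statesP[x1 _ _] := states_n n.
rewrite (le_trans (magD _ _)) // !magZ mag_phase x1 mul1r lerD //.
rewrite mag_pemb; last exact: ltW.
have := ropnorm_ge_ball (x_ n) TM (le_trans ler01 M_ge1); rewrite x1.
have := t_le n; have := t_gt0 n; have := mag_ge0 (iterate n (x_ n)).
by move: M_ge1; nra.
Qed.

Let step_small n : ropnorm (iterate n) <= M ->
  ropnorm (iterate n.+1 - iterate n) <= tau n - tau n.+1.
Proof.
move=> TM; rewrite -epsE; apply: ropnorm_leM => [|z].
  by rewrite mulr_ge0 ?ltW // (lt_le_trans _ B_ge2).
have -> : (iterate n.+1 - iterate n) z = (emb (eps n) * f_ n z) *: v_ n.
  by rewrite -[LHS]/(iterate n.+1 z - iterate n z) iterateS addrAC subrr add0r.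
rewrite magZ magM mag_pemb; last exact: ltW.
have /statesP[_ f1 _] := states_n n.
have := ropnorm_ge (f_ n) z; rewrite f1 mul1r => fz.
rewrite -(mulrA (eps n) (mag _)) -(mulrA (eps n) B); apply: ler_wpM2l; first exact: ltW.
by rewrite [leRHS]mulrC; apply: ler_pM; rewrite ?mag_ge0 ?mag_push.
Qed.

Let iterate_drift n : ropnorm (iterate n - T0) <= tau0 - tau n /\ ropnorm (iterate n) <= M.
Proof.
have H k : ropnorm (iterate k - T0) <= tau0 - tau k -> ropnorm (iterate k) <= M.
  move=> kT; have := ropnormD (iterate k - T0) T0; rewrite subrK /M.
  by have := tau_gt0 k; move: tau0_le1; lra.
suff T_n : ropnorm (iterate n - T0) <= tau0 - tau n by split=> //; exact: H.
elim: n => [|n IHn].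
  by rewrite /= !subrr; apply: ropnorm_leM => // z; rewrite mag0 mul0r.
have := step_small (H _ IHn).
have := ropnormD (iterate n.+1 - iterate n) (iterate n - T0).
by rewrite addrA subrK; lra.
Qed.

Let iterate_le n : ropnorm (iterate n) <= M.
Proof. by have [] := iterate_drift n. Qed.

Let iterate_cauchy n k : (n <= k)%N ->
  ropnorm (iterate k - iterate n) <= tau n - tau k.
Proof.
move/subnK <-; elim: (k - n)%N => [|m IHm].
  by rewrite add0n !subrr; apply: ropnorm_leM => // z; rewrite mag0 mul0r.
rewrite addSn; have := step_small (iterate_le (m + n)).
have := ropnormD (iterate (m + n).+1 - iterate (m + n)) (iterate (m + n) - iterate n).
by rewrite addrA subrK; lra.
Qed.

(** The perturbation increases the numerical radius by almost all of its value at
    the state that defines it. *)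
Let gain n : rnumradius (iterate n) + eps n * (1 + t n * rnumradius (iterate n))
  - 2 * tau n.+1 <= rnumradius (iterate n.+1).
Proof.
have /statesP[_ _ fx] := states_n n.
apply: le_trans (rnumradius_ge X0 _ (states_n n)).
have := near_max_n n; set c := f_ n (iterate n (x_ n)) => rc.
have -> : f_ n (iterate n.+1 (x_ n)) =
    phase (c : K) * emb (mag (c : K) + eps n * (1 + t n * mag (c : K))).
  rewrite iterateS fx mulr1 /v_ /push -/c linearD linearZ linearD !linearZ /=.
  rewrite fx -/c -[_ *: 1]/(_ * 1 : K) -[emb (t n) *: c]/(emb (t n) * c : K) mulr1.
  rewrite -[X in c + X]/(emb (eps n) * (phase (c : K) + emb (t n) * c) : K).
  rewrite -{1 3}(phaseE (c : K)) !rmorphD !rmorphM !rmorphD !rmorphM rmorph1.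
  by ring.
rewrite magM mag_phase mul1r.
have c0 := mag_ge0 (c : K); have e0 := eps_gt0 n; have t0 := t_gt0 n.
have e1 : eps n <= 1.
  rewrite ler_pdivrMr ?mul1r; last by have := B_ge2; lra.
  by have := tau_le1 n; have := tau_gt0 n.+1; have := B_ge2; lra.
have tc0 : 0 <= t n * mag (c : K) by rewrite mulr_ge0 // ltW.
rewrite mag_pemb; last first.
  by rewrite addr_ge0 //; apply: mulr_ge0; [exact: ltW|rewrite addr_ge0].
have et : eps n * t n <= 1 by have := t_le n; nra.
have tau1 := tau_gt0 n.+1.
have h1 : 0 <= eps n * t n * (mag (c : K) - rnumradius (iterate n) + tau n.+1).
  by apply: mulr_ge0; [exact/ltW/mulr_gt0|lra].
have h2 : 0 <= (1 - eps n * t n) * tau n.+1.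
  by apply: mulr_ge0; [lra|exact: ltW].
move: rc h1 h2; lra.
Qed.

(** Later perturbations are too small to lose the gain of step n, so the state k
    must retain it: the term f_n (x_k) f_k (v_n) that the perturbation contributes
    there has to be almost maximal, and |f_n (x_k)| <= 1. *)
Let later_states n k : (n < k)%N ->
  1 + t n * (rnumradius (iterate n) - 10 * B * t n) <= mag (f_ k (v_ n) : K).
Proof.
move=> nk; have tau1 := tau_gt0 n.+1.
have /statesP[xk1 fk1 _] := states_n k; have /statesP[_ fn1 _] := states_n n.
have h1 := near_max_n k.
have h2 := rnumradius_lipschitz X0 (iterate n.+1) (iterate k).
rewrite -ropnormN opprB in h2; have h3 := iterate_cauchy nk.
have h4 : mag (f_ k (iterate k (x_ k)) : K) <=
    mag (f_ k (iterate n.+1 (x_ k)) : K) + ropnorm (iterate k - iterate n.+1).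
  have -> : f_ k (iterate k (x_ k)) = f_ k (iterate n.+1 (x_ k)) +
      f_ k ((iterate k - iterate n.+1) (x_ k)).
    by rewrite -linearD; congr (f_ k _); rewrite /= addrC subrK.
  by rewrite (le_trans (magD _ _)) // lerD2l states_bound.
have h5 : mag (f_ k (iterate n.+1 (x_ k)) : K) <=
    rnumradius (iterate n) + eps n * mag (f_ k (v_ n) : K).
  rewrite iterateS linearD linearZ /=.
  apply: le_trans (magD _ _) _; apply: lerD; first exact: rnumradius_ge.
  rewrite magM magM mag_pemb; last exact: ltW.
  rewrite ler_wpM2r ?mag_ge0 // ler_piMr ?(ltW (eps_gt0 n)) //.
  by rewrite (le_trans (ropnorm_ge _ _)) // fn1 xk1 mulr1.
have h6 := gain n; have h7 := tau_decr (leqW nk).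
have h8 := tau_gt0 k.
have e0 := eps_gt0 n.
rewrite -(ler_pM2l e0).
have h9 : 5 * tau n.+1 <= eps n * (10 * B * t n * t n).
  have -> : eps n * (10 * B * t n * t n) = 10 * (t n ^+ 2) * (eps n * B) by ring.
  rewrite epsE; have := tauS n; have := tau_gt0 n => g2 g1.
  have -> : tau n.+1 = tau n * t n ^+ 2 by [].
  have t2 : 0 < t n ^+ 2 by rewrite exprn_gt0.
  have t4 : t n ^+ 2 <= 1 / 4 by have := t_le n; have := t_gt0 n; nra.
  have : 0 <= t n ^+ 2 * tau n * (1 / 4 - t n ^+ 2).
    by rewrite mulr_ge0 ?subr_ge0 // ltW // mulr_gt0.
  by have := mulr_gt0 t2 g2; lra.
have h10 : tau k.+1 <= tau n.+1 by exact/tau_decr/leqW.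
lra.
Qed.

(** The last clause keeps the state k almost extremal at all earlier directions,
    with an error quadratic in 1 / (n + 2). *)
Lemma lindenstrauss_iteration : exists (C : R) (S : op) (T_ : nat -> op)
    (x_ : nat -> X) (f_ : nat -> fn),
  [/\ ropnorm (S - T0) <= tau0,
      forall n, states (x_ n, f_ n),
      forall n, ropnorm (S - T_ n) <= C / n.+2%:R,
      forall n, ropnorm (T_ n) <= C &
      forall n, exists2 l : K, mag l = 1 & forall k, (n < k)%N ->
        1 + (n.+2%:R)^-1 * (rnumradius (T_ n) - C / n.+2%:R) <=
        mag (f_ k (l *: x_ n + emb (n.+2%:R)^-1 *: T_ n (x_ n)) : K)].
Proof.
have [|e e0|S ST] := @bop_limit _ _ _ _ iterate tau.
- by move=> n k nk; have := iterate_cauchy nk; have := tau_gt0 k; lra.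
- have [n nE] : exists n, (2 / e) < n%:R.
    by exists (Num.truncn (2 / e)).+1; exact: truncnS_gt.
  exists n; apply: le_lt_trans (tau_le_t n) _.
  rewrite /t ltr_pdivrMr ?ltr0n //; move: nE; rewrite ltr_pdivrMr // mulrC.
  by rewrite -!natr1; move: e0; nra.
have C0 : 0 <= M by move: M_ge1; lra.
exists (10 * B), S, iterate, x_, f_; split=> //.
- exact: (ST 0%N).
- move=> n; apply: le_trans (ST n) (le_trans (tau_le_t n) _).
  by rewrite -/(t n) ler_wpM2r ?ltW //; move: B_ge2; lra.
- by move=> n; apply: le_trans (iterate_le n) _; rewrite /B; lra.
- move=> n; exists (phase (f_ n (iterate n (x_ n)) : K)).
    exact: mag_phase.
  by move=> k; exact: later_states.
Qed.

End lindenstrauss.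

(** Let f be the weak-star limit of the f_k, and x the weak limit of the x_n. The
    iteration gives |f (x_n)| >= 1 - o(1) and |f (S x_n)| >= v(S) - o(1). Both f
    and f o S are functionals, so x inherits these bounds. *)
Theorem reflexive_numradius_dense (R : realType) (K : scalars R)
    (X : completeNormedModType K) :
  reflexive_space X -> @states K X !=set0 ->
  (forall (x : X) c, (forall f : {bop X -> K^o}, ropnorm f <= 1 -> mag (f x) <= c) ->
     mag x <= c) ->
  numradius_attaining_dense X.
Proof.
move=> Xr X0 norming T eps eps0.
have [e e0 epsE] := ge0_emb (ltW eps0).
have {}e0 : 0 < e by move: eps0; rewrite epsE -(rmorph0 (emb K)) ltr_emb.
pose tau0 := Num.min 1 (e / 2).
have tau0_gt0 : 0 < tau0 by rewrite /tau0 lt_min ltr01 divr_gt0.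
have tau0_le1 : tau0 <= 1 by rewrite /tau0 ge_min lexx.
have tau0_lt : tau0 < e.
  by apply: le_lt_trans (_ : e / 2 < e); [rewrite /tau0 ge_min lexx orbT|lra].
have [C [S [T_ [x_ [f_ [ST xf ST_ T_C later]]]]]] :=
  lindenstrauss_iteration X0 T tau0_gt0 tau0_le1.
have [U [UU Uoo]] := @ultraFilterLemma nat \oo _.
have UF : ProperFilter U by exact: ultra_proper.
have large n : U [set k | (n < k)%N] by apply: Uoo; exists n.+1.
have x1 n : mag (x_ n) = 1 by have /statesP[] := xf n.
have f1 n : ropnorm (f_ n) = 1 by have /statesP[] := xf n.
have [|f fle1 fU] := @weak_star_ulim _ _ _ _ UU X f_; first by move=> n; rewrite f1.
have x1le n : mag (x_ n) <= 1 by rewrite x1.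
have [x xU] := weak_ulim UU Xr x1le.
have fx_le z : mag (f z : K) <= mag z by rewrite -[leRHS]mul1r ropnorm_ge_ball.
have C0 : 0 <= C := le_trans (ropnorm_ge0 _) (T_C 0%N).
have t_gt0 n : 0 < (n.+2%:R : R)^-1 by rewrite invr_gt0 ltr0n.
have limit_push n : exists2 l : K, mag l = 1 &
    1 + (n.+2%:R)^-1 * (rnumradius (T_ n) - C / n.+2%:R) <=
    mag (f (l *: x_ n + emb K (n.+2%:R)^-1 *: T_ n (x_ n)) : K).
  have [l l1 lk] := later n; exists l => //.
  apply: (ulim_mag_ge UU (fU _)) => d d0; apply: filterS (large n) => k /= nk.
  by rewrite lerBlDr (le_trans (lk k nk)) // lerDl ltW.
have fx_n n : 1 - 2 * C / n.+2%:R <= mag (f (x_ n) : K) /\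
    rnumradius S - 3 * C / n.+2%:R <= mag (f (S (x_ n)) : K).
  have [l l1] := limit_push n.
  rewrite [f (_ + _)]linearD /= [f (l *: _)]linearZ /=.
  rewrite [f (emb _ _ *: _)]linearZ /=.
  set a := f (x_ n); set b := f (T_ n (x_ n)) => h1.
  have := le_trans h1 (magD (l * a : K) (emb K (n.+2%:R)^-1 * b)).
  rewrite !magM l1 mul1r mag_pemb ?(ltW (t_gt0 n)) // => {}h1.
  have a1 : mag (a : K) <= 1 by rewrite -(x1 n); exact: fx_le.
  have b1 : mag (b : K) <= C.
    rewrite (le_trans (fx_le _)) // -[leRHS]mulr1 -(x1 n) ropnorm_ge_ball //.
  have bS : mag (b : K) <= mag (f (S (x_ n)) : K) + C / n.+2%:R.
    have -> : b = f (S (x_ n)) - f ((S - T_ n) (x_ n)).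
      by rewrite -linearB; congr (f _); rewrite /= opprB addrC subrK.
    rewrite (le_trans (magB _ _)) // lerD2l (le_trans (fx_le _)) //.
    have := ropnorm_ge_ball (x_ n) (ST_ n); rewrite x1 mulr1; apply.
    by rewrite mulr_ge0 // ltW.
  have := rnumradius_lipschitz X0 S (T_ n) => h3; have h4 := ST_ n.
  have h5 := rnumradius_ge0 X0 (T_ n).
  move: (t_gt0 n) h1 bS h4; set t := (_ : R)^-1 => t0 h1 bS h4.
  have t1 : t <= 1 by rewrite invf_le1 ?ltr0n // ler1n.
  have tr0 : 0 <= t * rnumradius (T_ n) by rewrite mulr_ge0 // ltW.
  have tb0 : 0 <= t * (C - mag (b : K)) by rewrite mulr_ge0 ?subr_ge0 // ltW.
  have tt0 : 0 <= C * (t * (1 - t)).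
    by apply: mulr_ge0 => //; apply: mulr_ge0; [exact: ltW|lra].
  split; first by lra.
  have : t * (rnumradius (T_ n) - C * t) <= t * mag (b : K) by lra.
  by rewrite ler_pM2l // => ?; lra.
have tail (d c : R) : 0 < d -> 0 <= c -> U [set n | c / n.+2%:R < d].
  move=> d0 c0; apply: filterS (large (Num.truncn (c / d))) => n /= nN.
  have := truncnS_gt (c / d); rewrite ltr_pdivrMr // ltr_pdivrMr ?ltr0n // => h.
  by rewrite (lt_le_trans h) // mulrC ler_wpM2l ?(ltW d0) // ler_nat !leqW.
have fx_ge1 : 1 <= mag (f x : K).
  apply: (ulim_mag_ge UU (xU f)) => d d0.
  have := tail d (2 * C) d0; rewrite mulr_ge0 // => /(_ isT).
  apply: filterS => n /= nd; have [h _] := fx_n n.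
  by rewrite (le_trans _ h) // lerD2l lerN2 ltW.
have fSx_ge : rnumradius S <= mag (f (S x) : K).
  have lfS : linear (f \o S) by move=> a y z; rewrite /= !linearP.
  have bfS y : mag ((f \o S) y) <= ropnorm S * mag y.
    by rewrite (le_trans (fx_le _)) // ropnorm_ge.
  apply: (ulim_mag_ge UU (xU (mkbop lfS bfS))) => d d0.
  have := tail d (3 * C) d0; rewrite mulr_ge0 // => /(_ isT).
  apply: filterS => n /= nd; have [_ h] := fx_n n.
  by rewrite (le_trans _ h) // lerD2l lerN2 ltW.
have x_le1 : mag x <= 1.
  apply: norming => g g1; apply: (ulim_mag_le UU (xU g)) => d d0.
  apply: filterS filterT => n _ /=; rewrite -(x1 n).
  have := ropnorm_ge_ball (x_ n) g1 ler01; lra.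
have x_eq1 : mag x = 1 by apply/le_anti; rewrite x_le1 (le_trans fx_ge1).
have fx1 : mag (f x : K) = 1.
  by apply/le_anti; rewrite fx_ge1 andbT -x_eq1 fx_le.
pose g := (phase (f x : K))^-1 *: f.
have gE z : mag (g z : K) = mag (f z : K) by rewrite magM mag_phaseV mul1r.
have xg : states (x, g).
  apply/statesP; split=> //; last first.
    by rewrite -[LHS]/(_ * _ : K) phaseVE fx1 rmorph1.
  apply/le_anti/andP; split.
    by apply: ropnorm_leM => // z; rewrite gE mul1r.
  by have := ropnorm_ge g x; rewrite gE fx1 x_eq1 mulr1.
exists S.
  exists (x, g) => //; rewrite numradiusE // magE; congr (emb K _).
  by apply/le_anti; rewrite gE fSx_ge -gE rnumradius_ge.
by rewrite opnormE epsE ltr_emb -ropnormN opprB (le_lt_trans ST).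
Qed.

(** * The space l2 with an equivalent norm *)

Section finite_sums.
Context {R : realType}.
Implicit Types (a b : nat -> R) (n : nat).

Lemma cauchy_schwarz_sum n a b :
  (\sum_(i < n) a i * b i) ^+ 2 <=
  (\sum_(i < n) a i ^+ 2) * (\sum_(i < n) b i ^+ 2).
Proof.
elim: n => [|n IHn]; first by rewrite !big_ord0 expr0n mulr0.
have A0 : 0 <= \sum_(i < n) a i ^+ 2 by apply: sumr_ge0 => i _; exact: sqr_ge0.
have B0 : 0 <= \sum_(i < n) b i ^+ 2 by apply: sumr_ge0 => i _; exact: sqr_ge0.
rewrite !big_ord_recr /=; move: IHn A0 B0.
move: (\sum_(i < n) _) (\sum_(i < n) _) (\sum_(i < n) _) (a n) (b n).
move=> B A P x y PAB A0 B0.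
suff H : 2 * P * x * y <= A * y ^+ 2 + B * x ^+ 2 by nra.
have S0 : 0 <= A * y ^+ 2 + B * x ^+ 2.
  by rewrite addr_ge0 // mulr_ge0 // sqr_ge0.
rewrite real_leNgt ?num_real //; apply/negP => lt.
have : (A * y ^+ 2 + B * x ^+ 2) ^+ 2 < (2 * P * x * y) ^+ 2.
  by rewrite ltr_pXn2r // nnegrE // (le_trans S0) // ltW.
have : P ^+ 2 * (x * y) ^+ 2 <= A * B * (x * y) ^+ 2.
  by rewrite ler_wpM2r // sqr_ge0.
have := sqr_ge0 (A * y ^+ 2 - B * x ^+ 2).
lra.
Qed.

Lemma cauchy_schwarz_sqrt n a b : \sum_(i < n) a i * b i <=
  Num.sqrt (\sum_(i < n) a i ^+ 2) * Num.sqrt (\sum_(i < n) b i ^+ 2).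
Proof.
rewrite -sqrtrM; last by apply: sumr_ge0 => i _; exact: sqr_ge0.
rewrite (le_trans (ler_norm _)) // -sqrtr_sqr ler_wsqrtr //.
exact: cauchy_schwarz_sum.
Qed.

Lemma minkowski_sum n a b : Num.sqrt (\sum_(i < n) (a i + b i) ^+ 2) <=
  Num.sqrt (\sum_(i < n) a i ^+ 2) + Num.sqrt (\sum_(i < n) b i ^+ 2).
Proof.
set A := \sum_(i < n) a i ^+ 2; set B := \sum_(i < n) b i ^+ 2.
have A0 : 0 <= A by apply: sumr_ge0 => i _; exact: sqr_ge0.
have B0 : 0 <= B by apply: sumr_ge0 => i _; exact: sqr_ge0.
have -> : \sum_(i < n) (a i + b i) ^+ 2 =
    A + B + 2 * \sum_(i < n) a i * b i.
  rewrite mulr_sumr -!big_split /=; apply: eq_bigr => i _; ring.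
have S0 : 0 <= Num.sqrt A + Num.sqrt B by rewrite addr_ge0 ?sqrtr_ge0.
rewrite -[leRHS]ger0_norm // -sqrtr_sqr ler_wsqrtr //.
rewrite sqrrD !sqr_sqrtr // -mulr_natl.
have := cauchy_schwarz_sqrt n a b; rewrite -/A -/B; lra.
Qed.

Lemma geometric_half_sum n : \sum_(i < n) ((2:R) ^- i) <= 2.
Proof.
suff -> : \sum_(i < n) ((2:R) ^- i) = 2 - 2 * 2 ^- n.
  by rewrite lerBlDr lerDl mulr_ge0 // invr_ge0 exprn_ge0.
elim: n => [|n IHn]; first by rewrite big_ord0 expr0 invr1; lra.
by rewrite big_ord_recr /= IHn exprS invfM; lra.
Qed.

End finite_sums.

Section weight.
Context {R : realType}.
Definition wt i : R := 2 ^- i.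
Lemma wt_gt0 i : 0 < wt i. Proof. by rewrite invr_gt0 exprn_gt0. Qed.
Lemma wt_le1 i : wt i <= 1.
Proof. by rewrite invf_le1 ?exprn_gt0 // exprn_ege1 // ler1n. Qed.
End weight.

Section ell2.
Context {R : realType} {K : scalars R}.
Local Notation emb := (emb K).
Implicit Types (u v : nat -> K^o) (n : nat).

Definition sumsq n u : R := \sum_(i < n) mag (u i : K) ^+ 2.
Definition l2n n u : R := Num.sqrt (sumsq n u).
Definition l1n n u : R := \sum_(i < n) wt i * mag (u i : K).

Lemma sumsq_ge0 n u : 0 <= sumsq n u.
Proof. by apply: sumr_ge0 => i _; exact: sqr_ge0. Qed.

Lemma l2nK n u : l2n n u ^+ 2 = sumsq n u.
Proof. by rewrite sqr_sqrtr // sumsq_ge0. Qed.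

Lemma l2nD n u v : l2n n (u + v) <= l2n n u + l2n n v.
Proof.
apply: le_trans (minkowski_sum n (fun i => mag (u i : K)) (fun i => mag (v i : K))).
rewrite ler_wsqrtr // ler_sum // => i _.
by rewrite lerXn2r ?nnegrE ?addr_ge0 ?mag_ge0 // magD.
Qed.

Lemma l2nZ n a u : l2n n (a *: u) = mag a * l2n n u.
Proof.
rewrite /l2n -[mag a in RHS]ger0_norm ?mag_ge0 // -sqrtr_sqr -sqrtrM ?sqr_ge0 //.
by congr Num.sqrt; rewrite mulr_sumr; apply: eq_bigr => i _; rewrite -exprMn -magM.
Qed.

Lemma l1nD n u v : l1n n (u + v) <= l1n n u + l1n n v.
Proof.
rewrite /l1n -big_split; apply: ler_sum => i _ /=.
by rewrite -mulrDr ler_wpM2l ?(ltW (wt_gt0 _)) // magD.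
Qed.

Lemma l1nZ n a u : l1n n (a *: u) = mag a * l1n n u.
Proof. by rewrite mulr_sumr; apply: eq_bigr => i _; rewrite mulrCA -magM. Qed.

Lemma l2n_le_sum n u : l2n n u <= \sum_(i < n) mag (u i : K).
Proof.
have S0 m : 0 <= \sum_(i < m) mag (u i : K).
  by apply: sumr_ge0 => i _; exact: mag_ge0.
rewrite -[leRHS]ger0_norm // -sqrtr_sqr ler_wsqrtr // /sumsq.
elim: n => [|n IHn]; first by rewrite !big_ord0 expr0n.
rewrite !big_ord_recr /=; have := S0 n; have := mag_ge0 (u n : K); nra.
Qed.

Lemma l1n_le_sum n u : l1n n u <= \sum_(i < n) mag (u i : K).
Proof. by apply: ler_sum => i _; rewrite ler_piMl ?mag_ge0 ?wt_le1. Qed.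

Lemma mag_le_l2n n u i : (i < n)%N -> mag (u i : K) <= l2n n u.
Proof.
move=> i_n; rewrite -[leLHS]ger0_norm ?mag_ge0 // -sqrtr_sqr ler_wsqrtr //.
rewrite /sumsq (bigD1 (Ordinal i_n)) //= lerDl.
by apply: sumr_ge0 => j _; exact: sqr_ge0.
Qed.

Definition square_summable : {pred nat -> K^o} :=
  mem [set u : nat -> K^o | exists M : R, forall n, l2n n u <= M].

Record ell2 := Ell2 { seq_of :> nat -> K^o; seq_ofP : seq_of \in square_summable }.

HB.instance Definition _ := [isSub for seq_of].
HB.instance Definition _ := [Choice of ell2 by <:].

Lemma square_summable_submod : submod_closed square_summable.
Proof.
split=> [|a u v].
  rewrite inE; exists 0 => n; rewrite -[X in l2n n X](scale0r 0) l2nZ.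
  by rewrite mag0 mul0r.
rewrite !inE => -[M uM] [N vN]; exists (mag a * M + N) => n.
by rewrite (le_trans (l2nD _ _ _)) // l2nZ lerD // ler_wpM2l ?mag_ge0.
Qed.

HB.instance Definition _ := GRing.isSubmodClosed.Build K (nat -> K^o)
  square_summable square_summable_submod.
HB.instance Definition _ := [SubChoice_isSubLmodule of ell2 by <:].

Implicit Types (x y z : ell2).

Lemma ell2_ext x y : x =1 y -> x = y.
Proof. by move=> xy; apply/val_inj/funext. Qed.

Definition l2 x : R := sup (range (l2n^~ x)).
Definition l1 x : R := sup (range (l1n^~ x)).

Lemma l2n_le x n : l2n n x <= l2 x.
Proof.
apply: ub_le_sup; last by exists n.
by have := seq_ofP x; rewrite inE => -[M xM]; exists M => _ [m _ <-].
Qed.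

Lemma l2_le x c : (forall n, l2n n x <= c) -> l2 x <= c.
Proof. by move=> xc; apply: ge_sup => [|_ [n _ <-]//]; exists (l2n 0 x), 0%N. Qed.

Lemma l2_ge0 x : 0 <= l2 x.
Proof. by apply: le_trans (l2n_le x 0); exact: sqrtr_ge0. Qed.

Lemma mag_le_l2 x i : mag (x i : K) <= l2 x.
Proof. by apply: le_trans (l2n_le x i.+1); exact: mag_le_l2n. Qed.

Lemma l1n_le2 x n : l1n n x <= 2 * l2 x.
Proof.
apply: le_trans (_ : \sum_(i < n) wt i * l2 x <= _).
  by apply: ler_sum => i _; rewrite ler_wpM2l ?(ltW (wt_gt0 _)) // mag_le_l2.
rewrite -mulr_suml ler_wpM2r ?l2_ge0 //; exact: geometric_half_sum.
Qed.

Lemma l1n_le x n : l1n n x <= l1 x.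
Proof.
apply: ub_le_sup; last by exists n.
by exists (2 * l2 x) => _ [m _ <-]; exact: l1n_le2.
Qed.

Lemma l1_le x c : (forall n, l1n n x <= c) -> l1 x <= c.
Proof. by move=> xc; apply: ge_sup => [|_ [n _ <-]//]; exists (l1n 0 x), 0%N. Qed.

Lemma l2D x y : l2 (x + y) <= l2 x + l2 y.
Proof.
by apply: l2_le => n; rewrite (le_trans (l2nD _ _ _)) // lerD ?l2n_le.
Qed.

Lemma l1D x y : l1 (x + y) <= l1 x + l1 y.
Proof.
by apply: l1_le => n; rewrite (le_trans (l1nD _ _ _)) // lerD ?l1n_le.
Qed.

Lemma l2Z a x : l2 (a *: x) = mag a * l2 x.
Proof.
have le b z : l2 (b *: z) <= mag b * l2 z.
  by apply: l2_le => n; rewrite l2nZ ler_wpM2l ?mag_ge0 ?l2n_le.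
apply/le_anti; rewrite le /=; have [->|a0] := eqVneq a 0.
  by rewrite mag0 mul0r l2_ge0.
rewrite -ler_pdivlMl ?mag_gt0 // -magV -{1}(scalerK a0 x); exact: le.
Qed.

Lemma l1_ge0 x : 0 <= l1 x.
Proof. by apply: le_trans (l1n_le x 0); rewrite /l1n big_ord0. Qed.

Lemma l1Z a x : l1 (a *: x) = mag a * l1 x.
Proof.
have le b z : l1 (b *: z) <= mag b * l1 z.
  by apply: l1_le => n; rewrite l1nZ ler_wpM2l ?mag_ge0 ?l1n_le.
apply/le_anti; rewrite le /=; have [->|a0] := eqVneq a 0.
  by rewrite mag0 mul0r l1_ge0.
rewrite -ler_pdivlMl ?mag_gt0 // -magV -{1}(scalerK a0 x); exact: le.
Qed.

(** With the factor 1/4 the weighted part dominates at e_0, at e_1 and around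
    the segment from e_0 to 2 e_1. *)
Definition ell2_norm x : R := Num.max (l2 x / 4) (l1 x).

Let normD x y : emb (ell2_norm (x + y)) <= emb (ell2_norm x) + emb (ell2_norm y).
Proof.
rewrite -rmorphD ler_emb /ell2_norm ge_max.
apply/andP; split.
  apply: le_trans (_ : l2 x / 4 + l2 y / 4 <= _).
    by rewrite -mulrDl ler_wpM2r // l2D.
  by apply: lerD; rewrite le_max lexx.
by apply: le_trans (l1D x y) _; apply: lerD; rewrite le_max lexx orbT.
Qed.

Let normZ (a : K) x : emb (ell2_norm (a *: x)) = `|a| * emb (ell2_norm x).
Proof.
by rewrite magE -rmorphM /ell2_norm maxr_pMr ?mag_ge0 // mulrA -l2Z -l1Z.
Qed.

Let norm0 x : emb (ell2_norm x) = 0 -> x = 0.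
Proof.
rewrite -(rmorph0 emb) => /emb_inj x0; apply: ell2_ext => i.
apply/eqP; rewrite -mag_eq0; apply/eqP/le_anti; rewrite mag_ge0 andbT.
apply: le_trans (mag_le_l2 x i) _.
have : l2 x / 4 <= 0 by rewrite -x0 le_max lexx.
lra.
Qed.

HB.instance Definition _ :=
  Lmodule_isNormed.Build K ell2 normD normZ norm0.

Lemma mag_ell2 x : mag x = Num.max (l2 x / 4) (l1 x).
Proof. by rewrite /mag embK. Qed.

Lemma l1_le_mag x : l1 x <= mag x.
Proof. by rewrite mag_ell2 le_max lexx orbT. Qed.

Lemma l2_le_mag x : l2 x <= 4 * mag x.
Proof.
have : l2 x / 4 <= mag x by rewrite mag_ell2 le_max lexx.
lra.
Qed.

Lemma mag_le_ell2 x c : l2 x <= 4 * c -> l1 x <= c -> mag x <= c.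
Proof. by move=> h1 h2; rewrite mag_ell2 ge_max h2 andbT; lra. Qed.

Lemma mag_le_l2M x : mag x <= 2 * l2 x.
Proof.
apply: mag_le_ell2; first by have := l2_ge0 x; lra.
by apply: l1_le => n; exact: l1n_le2.
Qed.

Lemma mag_coord x i : mag (x i : K) <= 4 * mag x.
Proof. exact: le_trans (mag_le_l2 x i) (l2_le_mag x). Qed.

(** Lower semicontinuity of the norm for coordinatewise convergence: it holds for
    the partial sums, which depend on finitely many coordinates. *)
Lemma coordinatewise_limit (I : Type) (U : set_system I) (x_ : I -> ell2)
    (u : nat -> K^o) (a : ell2) (c : R) : UltraFilter U ->
  (forall i, ulim U (fun t => x_ t i : K) (u i)) ->
  U [set t | mag (x_ t - a) <= c] ->
  exists2 y : ell2, seq_of y = u & mag (y - a) <= c.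
Proof.
move=> UU xu Uc; have UF : ProperFilter U by exact: ultra_proper.
have near n (d : R) : 0 < d ->
    U [set t | \sum_(i < n) mag (u i - x_ t i : K) <= d].
  elim: n d => [|n IHn] d d0.
    by apply: filterS filterT => t _ /=; rewrite big_ord0 ltW.
  have d20 : 0 < d / 2 by lra.
  apply: filterS (filterI (IHn _ d20) (xu n _ d20)) => t [/= h1 h2].
  by rewrite big_ord_recr /= mag_distC in h2 *; move: h1 h2; lra.
have ue (q : nat -> (nat -> K^o) -> R) (b : R) :
    (forall n v w, q n (v + w) <= q n v + q n w) ->
    (forall n v, q n v <= \sum_(i < n) mag (v i : K)) ->
    (forall n x, q n x <= b * mag x) -> 0 <= b ->
    forall n, q n (u - seq_of a) <= b * c.
  move=> qD qle qb b0 n; apply/ler_addgt0Pr => d d0.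
  have [t [/= h1 h2]] := filter_ex (filterI Uc (near n d d0)).
  have -> : u - seq_of a = (u - x_ t) + seq_of (x_ t - a).
    by rewrite addrA subrK.
  apply: le_trans (qD _ _ _) _; rewrite addrC; apply: lerD.
    by apply: le_trans (qb _ _) _; rewrite ler_wpM2l.
  exact: le_trans (qle _ _) h2.
have u2 := ue l2n 4 l2nD l2n_le_sum
  (fun n x => le_trans (l2n_le x n) (l2_le_mag x)) (ler0n _ 4).
have u1 := ue l1n 1 l1nD l1n_le_sum _ ler01.
have uP : u \in square_summable.
  rewrite inE; exists (4 * c + l2 a) => n.
  rewrite -[u](subrK (seq_of a)) (le_trans (l2nD _ _ _)) // lerD //.
  exact: l2n_le.
exists (Ell2 uP) => //; apply: mag_le_ell2; first exact: l2_le.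
apply: l1_le => n; rewrite -[c]mul1r; apply: u1 => m x.
by rewrite mul1r (le_trans (l1n_le x m)) // l1_le_mag.
Qed.

(** The limit is taken coordinatewise along an ultrafilter finer than F; the Cauchy
    bounds survive by lower semicontinuity. *)
Lemma ell2_complete (F : set_system ell2) : ProperFilter F -> cauchy F -> cvg F.
Proof.
move=> FF /cauchyP Fc.
have {}Fc (d : R) : 0 < d -> exists a : ell2, F [set x | mag (x - a) <= d].
  move=> d0; have [|a Fa] := Fc (emb d); first by rewrite -(rmorph0 emb) ltr_emb.
  exists a; apply: filterS Fa => x; rewrite -ball_normE /= lt_mag mag_distC.
  exact: ltW.
have [U [UU FU]] := ultraFilterLemma FF.
have UF : ProperFilter U by exact: ultra_proper.
have [a Fa] := Fc 1 ltr01.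
have /choice[u uU] : forall i, exists l : K^o, ulim U (fun x : ell2 => x i : K) l.
  move=> i; apply: (@ulim_ex _ _ _ _ UU _ (4 * (1 + mag a))).
  apply: filterS (FU _ Fa) => x /= xa; apply: le_trans (mag_coord x i) _.
  by rewrite ler_wpM2l // -lerBlDr (le_trans (magB_ge _ _)).
have [y yE _] := coordinatewise_limit UU uU (FU _ Fa).
apply/cvg_ex; exists y; apply/cvgrPdist_lt => e e0.
have [d _ dE] := ge0_emb (ltW e0).
move: e0; rewrite dE -(rmorph0 emb) ltr_emb => d0.
have d30 : 0 < d / 3 by lra.
have d3E : d = d / 3 + (d / 3 + d / 3) by lra.
have [b Fb] := Fc _ d30; apply: filterS (Fb) => x /= xb; rewrite lt_mag.
have [y' y'E yb] := coordinatewise_limit UU uU (FU _ Fb).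
have yy' : y' = y by apply: ell2_ext => i; rewrite y'E yE.
move: yb; rewrite yy' => yb; rewrite (le_lt_trans (mag_tri b y x)) // d3E.
by rewrite ler_ltD // (mag_distC b x) (le_lt_trans xb) // ltrDl.
Qed.

HB.instance Definition _ := Uniform_isComplete.Build ell2 ell2_complete.

Definition ell2_space : completeNormedModType K := ell2.

End ell2.

(** * Reflexivity *)

Section finite_support.
Context {R : realType} {K : scalars R}.
Local Notation emb := (emb K).
Local Notation ell2 := (@ell2 R K).
Implicit Types (c u : nat -> K^o) (n m : nat) (x y z : ell2).

Definition cut n c : nat -> K^o := fun i => if (i < n)%N then c i else 0.

Lemma sumsqS n c : sumsq n.+1 c = sumsq n c + mag (c n : K) ^+ 2.
Proof. by rewrite /sumsq big_ord_recr. Qed.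

Lemma sumsq_mono m n c : (m <= n)%N -> sumsq m c <= sumsq n c.
Proof.
move/subnK <-; elim: (n - m)%N => // k; rewrite addSn sumsqS => /le_trans.
by apply; rewrite lerDl sqr_ge0.
Qed.

Lemma l2n_cut m n c : l2n m (cut n c) <= l2n n c.
Proof.
rewrite ler_wsqrtr //; elim: m => [|m IHm].
  by rewrite /sumsq big_ord0 sumsq_ge0.
rewrite sumsqS {2}/cut; case: ifP => mn; last by rewrite mag0 expr0n addr0.
have -> : sumsq m (cut n c) = sumsq m c.
  by apply: eq_bigr => i _; rewrite /cut (ltn_trans (ltn_ord i) mn).
by rewrite -sumsqS sumsq_mono.
Qed.

Lemma cut_summable n c : cut n c \in square_summable.
Proof. by rewrite inE; exists (l2n n c) => m; exact: l2n_cut. Qed.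

Definition fin n c : ell2 := Ell2 (cut_summable n c).

Lemma finE n c i : fin n c i = if (i < n)%N then c i else 0.
Proof. by []. Qed.

Lemma l2_fin n c : l2 (fin n c) <= l2n n c.
Proof. by apply: l2_le => m; exact: l2n_cut. Qed.

Definition unit_vec i : ell2 := fin i.+1 (fun j => (j == i)%:R).

Lemma unit_vecE i j : unit_vec i j = (j == i)%:R.
Proof.
rewrite finE; case: ifP => // /negbT; rewrite -leqNgt => ij.
by rewrite gtn_eqF.
Qed.

Lemma ell2Z_E (a : K) x i : (a *: x) i = a * x i.
Proof. by []. Qed.

Lemma ell2D_E x y i : (x + y) i = x i + y i.
Proof. by []. Qed.

Lemma ell2B_E x y i : (x - y) i = x i - y i.
Proof. by []. Qed.

Lemma finS n c : fin n.+1 c = fin n c + (c n : K) *: unit_vec n.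
Proof.
apply: ell2_ext => i; rewrite ell2D_E ell2Z_E unit_vecE !finE.
rewrite ltnS leq_eqVlt; have [->|] := eqVneq i n.
  by rewrite ltnn mulr1 add0r.
by rewrite mulr0 addr0.
Qed.

Lemma bop_fin (f : {bop ell2 -> K^o}) n c :
  f (fin n c) = \sum_(i < n) (c i : K) * f (unit_vec i).
Proof.
elim: n => [|n IHn].
  rewrite big_ord0 (_ : fin 0 c = 0) ?linear0 //.
  by apply: ell2_ext => i; rewrite finE.
by rewrite finS linearD linearZ /= IHn big_ord_recr.
Qed.

Lemma sumsq_tail n m x :
  sumsq m (x - fin n x : ell2) + sumsq n x <= sumsq (maxn m n) x.
Proof.
elim: m => [|m IHm]; first by rewrite max0n {1}/sumsq big_ord0 add0r.
rewrite sumsqS ell2B_E finE; case: ltnP => [mn|nm].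
  rewrite subrr mag0 expr0n addr0; move: IHm.
  by rewrite (maxn_idPr mn) (maxn_idPr (ltnW mn)).
rewrite subr0 addrAC (maxn_idPl (leqW nm)) sumsqS lerD2r.
by move: IHm; rewrite (maxn_idPl nm).
Qed.

Lemma ell2_tail x (e : R) : 0 < e ->
  exists N, forall n, (N <= n)%N -> l2 (x - fin n x) <= e.
Proof.
move=> e0; have x2 n : sumsq n x <= l2 x ^+ 2.
  by rewrite -l2nK lerXn2r ?nnegrE ?l2n_le ?l2_ge0 ?sqrtr_ge0.
pose A := range (fun n => sumsq n x).
have supA : has_sup A.
  split; first by exists (sumsq 0 x), 0%N.
  by exists (l2 x ^+ 2) => _ [n _ <-].
have e20 : 0 < e ^+ 2 by rewrite exprn_gt0.
have [_ [N _ <-] N_e] := sup_adherent e20 supA.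
exists N => n Nn; apply: l2_le => m.
have Nle : sumsq N x <= sumsq n x by exact: sumsq_mono.
rewrite -[leRHS]ger0_norm ?(ltW e0) // -sqrtr_sqr ler_wsqrtr //.
have : sumsq (maxn m n) x <= sup A by apply: ub_le_sup; [have [] := supA | exists (maxn m n)].
have := sumsq_tail n m x; lra.
Qed.

Lemma mag_tail x (e : R) : 0 < e ->
  exists N, forall n, (N <= n)%N -> mag (x - fin n x) <= e.
Proof.
move=> e0; have [|N xN] := @ell2_tail x (e / 2); first by rewrite divr_gt0.
exists N => n /xN h; apply: le_trans (mag_le_l2M _) _; lra.
Qed.

Lemma cs_mag n u c :
  \sum_(i < n) mag (u i : K) * mag (c i : K) <= l2n n u * l2n n c.
Proof.
exact: (cauchy_schwarz_sqrt n (fun i => mag (u i : K)) (fun i => mag (c i : K))).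
Qed.

Lemma fin_form_linear n c : linear (fun x : ell2 => \sum_(i < n) (c i : K) * x i : K^o).
Proof.
move=> a x y.
transitivity (\sum_(i < n) (a * (c i * x i) + c i * y i : K)).
  by apply: eq_bigr => i _; rewrite ell2D_E ell2Z_E mulrDr mulrCA.
by rewrite big_split -mulr_sumr.
Qed.

Lemma fin_form_bounded_l2 n c x :
  mag (\sum_(i < n) (c i : K) * x i : K) <= l2n n c * l2 x.
Proof.
apply: le_trans (mag_sum _ _ _) _.
under eq_bigr do rewrite magM.
apply: le_trans (cs_mag n c x) _.
by rewrite ler_wpM2l ?sqrtr_ge0 // l2n_le.
Qed.

Lemma fin_form_bounded n c x :
  mag (\sum_(i < n) (c i : K) * x i : K) <= 4 * l2n n c * mag x.
Proof.
apply: le_trans (fin_form_bounded_l2 n c x) _.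
by rewrite mulrAC mulrC ler_wpM2r ?sqrtr_ge0 // l2_le_mag.
Qed.

Definition fin_form n c : {bop ell2 -> K^o} :=
  mkbop (fin_form_linear n c) (fin_form_bounded n c).

Lemma fin_formE n c x : fin_form n c x = \sum_(i < n) (c i : K) * x i.
Proof. by []. Qed.

Definition ell2_coord i : {bop ell2 -> K^o} := fin_form i.+1 (fun j => (j == i)%:R).

Lemma ell2_coordE i x : ell2_coord i x = x i.
Proof.
rewrite fin_formE big_ord_recr /= eqxx mul1r big1 ?add0r // => j _.
by rewrite ltn_eqF // mul0r.
Qed.

Lemma fin_formS n c : fin_form n.+1 c = fin_form n c + (c n : K) *: ell2_coord n.
Proof.
apply: bop_ext => x; rewrite fin_formE big_ord_recr /=.
by congr (_ + _); rewrite -[RHS]/(c n * ell2_coord n x) ell2_coordE.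
Qed.

Lemma ropnorm_fin_form n c : ropnorm (fin_form n c) <= 4 * l2n n c.
Proof.
by apply: ropnorm_leM; [rewrite mulr_ge0 ?sqrtr_ge0 | exact: fin_form_bounded].
Qed.

Lemma linear_fin_form (F : {linear {bop ell2 -> K^o} -> K^o}) n c :
  F (fin_form n c) = \sum_(i < n) (c i : K) * F (ell2_coord i).
Proof.
elim: n => [|n IHn].
  rewrite big_ord0 (_ : fin_form 0 c = 0) ?linear0 //.
  by apply: bop_ext => x; rewrite fin_formE big_ord0.
by rewrite fin_formS linearD linearZ /= IHn big_ord_recr.
Qed.

(** The conjugate of a, in a form that makes sense in any field of scalars. *)
Definition conjugate (a : K) : K := (phase a)^-1 * emb (mag a).

Lemma conjugateM a : conjugate a * a = emb (mag a ^+ 2).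
Proof. by rewrite /conjugate mulrAC phaseVE -rmorphM. Qed.

Lemma mag_conjugate a : mag (conjugate a) = mag a.
Proof. by rewrite magM mag_phaseV mul1r mag_pemb ?mag_ge0. Qed.

Lemma l2n_conjugate n c : l2n n (fun i => conjugate (c i)) = l2n n c.
Proof. by congr Num.sqrt; apply: eq_bigr => i _; rewrite mag_conjugate. Qed.

Lemma sum_conjugate n c :
  \sum_(i < n) conjugate (c i) * c i = emb (sumsq n c) :> K.
Proof. by rewrite rmorph_sum; apply: eq_bigr => i _; rewrite conjugateM. Qed.

(** Test f on the conjugates of its own first n coefficients: the value is the sum
    of squares, while the norm of the vector is of the order of its root. *)
Lemma bop_coef_summable (f : {bop ell2 -> K^o}) :
  (fun i => f (unit_vec i)) \in square_summable.
Proof.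
rewrite inE; exists (2 * ropnorm f) => n; set c := fun i => _.
have := ropnorm_ge f (fin n (fun i => conjugate (c i))).
rewrite bop_fin (sum_conjugate n c) mag_pemb ?sumsq_ge0 // -l2nK.
have := mag_le_l2M (fin n (fun i => conjugate (c i))).
have := l2_fin n (fun i => conjugate (c i)); rewrite l2n_conjugate.
have := ropnorm_ge0 f; have : 0 <= l2n n c by exact: sqrtr_ge0.
move: (l2n n c) (l2 _) (mag _) (ropnorm f) => s t p r s0 r0 ts pt h.
rewrite real_leNgt ?num_real //; apply/negP => lt.
have h2 : r * p <= r * (2 * s) by rewrite ler_wpM2l //; lra.
have s1 : 0 < s by lra.
have : 0 < s * (s - 2 * r) by rewrite mulr_gt0 ?subr_gt0.
lra.
Qed.

(** By Cauchy-Schwarz the error is controlled by the tail of the coefficients of f,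
    first on finitely supported vectors and then by continuity. *)
Lemma fin_form_approx (f : {bop ell2 -> K^o}) (e : R) : 0 < e ->
  exists n, ropnorm (f - fin_form n (fun i => f (unit_vec i))) <= e.
Proof.
move=> e0; pose c := Ell2 (bop_coef_summable f).
have [|N cN] := @ell2_tail c (e / 4); first by rewrite divr_gt0.
exists N; apply: ropnorm_leM; first exact: ltW.
move=> x; apply/ler_addgt0Pr => d d0.
have [|M xM] := @mag_tail x (d / (ropnorm f + 1)).
  by rewrite divr_gt0 // ltr_wpDl ?ropnorm_ge0.
pose m := maxn M N; have := xM m (leq_maxl _ _) => xm.
have -> : (f - fin_form N (fun i => f (unit_vec i))) x =
    f (x - fin m x) + \sum_(i < m) (c - fin N c) i * x i.
  have fB : f (x - fin m x) = f x - \sum_(i < m) (c i : K) * x i.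
    rewrite bopB bop_fin; congr (_ - _); apply: eq_bigr => i _.
    exact: mulrC.
  have cB : \sum_(i < m) ((c - fin N c) i : K) * x i =
      \sum_(i < m) (c i : K) * x i - \sum_(i < N) (c i : K) * x i.
    rewrite (big_ord_widen m (fun i => (c i : K) * x i) (leq_maxr M N)).
    rewrite [X in _ = _ - X]big_mkcond -sumrB; apply: eq_bigr => i _.
    rewrite ell2B_E finE mulrBl; congr (_ - _).
    by case: ifP => _; rewrite ?mul0r.
  rewrite -[LHS]/(f x - \sum_(i < N) (c i : K) * x i) fB.
  by rewrite cB addrA subrK.
apply: le_trans (magD _ _) _; rewrite addrC; apply: lerD.
  apply: le_trans (fin_form_bounded m (c - fin N c : ell2) x) _.
  rewrite ler_wpM2r ?mag_ge0 //.
  have := le_trans (l2n_le (c - fin N c) m) (cN N (leqnn N)); lra.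
apply: le_trans (ropnorm_ge f _) _.
apply: le_trans (_ : (ropnorm f + 1) * (d / (ropnorm f + 1)) <= _).
  by apply: ler_pM; rewrite ?ropnorm_ge0 ?mag_ge0 // lerDl.
by rewrite mulrC divfK // gt_eqF // ltr_wpDl ?ropnorm_ge0.
Qed.

Theorem ell2_reflexive : reflexive_space (@ell2_space R K).
Proof.
move=> F [M FM].
have {}FM (f : {bop ell2 -> K^o}) : mag (F f : K) <= mag M * ropnorm f.
  have := FM f; rewrite opnormE => h.
  have /ger0_norm Mf := le_trans (normr_ge0 _) h.
  by rewrite -Mf normrM (ger0_norm (emb_ge0 K (ropnorm_ge0 f))) (magE M) -rmorphM le_mag in h.
pose u : nat -> K^o := fun i => F (ell2_coord i).
have uP : u \in square_summable.
  rewrite inE; exists (4 * mag M) => n.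
  have := FM (fin_form n (fun i => conjugate (u i))).
  rewrite linear_fin_form (sum_conjugate n u) mag_pemb ?sumsq_ge0 // -l2nK => h1.
  have := ropnorm_fin_form n (fun i => conjugate (u i)); rewrite l2n_conjugate.
  have : 0 <= l2n n u by exact: sqrtr_ge0.
  move: (l2n n u) (ropnorm _) (mag M) (mag_ge0 M) h1 => s r b b0 h1 s0 h2.
  rewrite real_leNgt ?num_real //; apply/negP => lt.
  have h3 : b * r <= b * (4 * s) by rewrite ler_wpM2l.
  have s1 : 0 < s by lra.
  have : 0 < s * (s - 4 * b) by rewrite mulr_gt0 ?subr_gt0.
  lra.
exists (Ell2 uP) => f; set x := Ell2 uP.
apply/eqP; rewrite -subr_eq0 -(@mag_eq0 R K K); apply/eqP/le_anti.
rewrite mag_ge0 andbT; apply/ler_addgt0Pr => e e0; rewrite add0r.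
have C0 : 0 < mag M + mag x + 1 by rewrite ltr_wpDl // addr_ge0 ?mag_ge0.
have [|n fn] := @fin_form_approx f (e / (mag M + mag x + 1)); first by rewrite divr_gt0.
set g := fin_form n _ in fn.
have -> : F f - f x = F (f - g) - (f - g) x :> K.
  rewrite linearB -[X in _ = _ - X]/(f x - g x).
  suff -> : F g = g x by rewrite opprB addrA subrK.
  by rewrite linear_fin_form fin_formE.
apply: le_trans (magB _ _) _.
apply: le_trans (lerD (FM _) (ropnorm_ge _ _)) _.
rewrite [X in _ + X]mulrC -mulrDl.
apply: le_trans (_ : (mag M + mag x + 1) * (e / (mag M + mag x + 1)) <= _).
  by apply: ler_pM; rewrite ?addr_ge0 ?mag_ge0 ?ropnorm_ge0 // lerDl.
by rewrite mulrC divfK // gt_eqF.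
Qed.

(** Both parts of the norm are suprema of values of finitely supported functionals
    of norm at most 1. *)
Lemma ell2_norming x (b : R) :
  (forall f : {bop ell2 -> K^o}, ropnorm f <= 1 -> mag (f x : K) <= b) -> mag x <= b.
Proof.
move=> xb; apply: mag_le_ell2; [apply: l2_le|apply: l1_le] => n.
  have [|s0] := leP (l2n n x) 0.
    have b0 : 0 <= b.
      apply: le_trans (xb 0 _); first exact: mag_ge0.
      by apply: ropnorm_leM => // z; rewrite mag0 mul1r mag_ge0.
    by move/le_trans; apply; rewrite mulr_ge0.
  set s := l2n n x in s0 *.
  pose c i : K^o := emb (4 * s)^-1 * conjugate (x i).
  have s40 : 0 <= (4 * s)^-1 by rewrite invr_ge0 mulr_ge0 // ltW.
  have := xb (fin_form n c); rewrite fin_formE.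
  under eq_bigr do rewrite -mulrA.
  rewrite -mulr_sumr (sum_conjugate n x) -rmorphM mag_pemb; last first.
    by rewrite mulr_ge0 ?sumsq_ge0.
  rewrite -l2nK -/s.
  have -> : (4 * s)^-1 * s ^+ 2 = s / 4.
    by field; rewrite gt_eqF.
  move=> h; suff : s / 4 <= b by lra.
  apply: h; apply: ropnorm_leM => // z; rewrite fin_formE.
  apply: le_trans (fin_form_bounded_l2 n c z) _.
  rewrite (_ : l2n n c = 4^-1); first by have := l2_le_mag z; lra.
  have -> : c = emb (4 * s)^-1 *: (fun i => conjugate (x i) : K^o) by [].
  rewrite l2nZ l2n_conjugate mag_pemb // -/s.
  by field; rewrite gt_eqF.
pose c i : K^o := emb (wt i) * (phase (x i : K))^-1.
have := xb (fin_form n c); rewrite fin_formE.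
have -> : \sum_(i < n) c i * x i = emb (l1n n x) :> K.
  rewrite rmorph_sum; apply: eq_bigr => i _.
  by rewrite /c -mulrA phaseVE -rmorphM.
rewrite mag_pemb; last first.
  by apply: sumr_ge0 => i _; rewrite mulr_ge0 ?mag_ge0 ?(ltW (wt_gt0 _)).
apply; apply: ropnorm_leM => // z; rewrite fin_formE mul1r.
apply: le_trans (l1_le_mag z); apply: le_trans (l1n_le z n).
apply: le_trans (mag_sum _ _ _) _; apply: ler_sum => i _.
by rewrite !magM mag_phaseV mulr1 mag_pemb ?(ltW (wt_gt0 _)).
Qed.

End finite_support.

(** * Failure of the Bishop-Phelps-Bollobas property *)

Section failure.
Context {R : realType} {K : scalars R}.
Local Notation emb := (emb K).
Local Notation ell2 := (@ell2 R K).
Local Notation e_ := (@unit_vec R K).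
Implicit Types (x y z : ell2) (f g : {bop ell2 -> K^o}).

Lemma wt0 : @wt R 0 = 1. Proof. by rewrite /wt expr0 invr1. Qed.
Lemma wt1 : @wt R 1 = 1 / 2. Proof. by rewrite /wt expr1 div1r. Qed.

Lemma l1n_mono m n x : (m <= n)%N -> l1n m x <= l1n n x.
Proof.
move/subnK <-; elim: (n - m)%N => // k; rewrite addSn => /le_trans; apply.
by rewrite /l1n big_ord_recr lerDl mulr_ge0 ?mag_ge0 ?(ltW (wt_gt0 _)).
Qed.

Lemma wt_coord_le_l1 x i : wt i * mag (x i : K) <= l1 x.
Proof.
apply: le_trans (l1n_le x i.+1); rewrite /l1n big_ord_recr /= lerDr.
by apply: sumr_ge0 => j _; rewrite mulr_ge0 ?mag_ge0 ?(ltW (wt_gt0 _)).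
Qed.

Lemma two_coords_le_l1 x i j : (i < j)%N ->
  wt i * mag (x i : K) + wt j * mag (x j : K) <= l1 x.
Proof.
move=> ij; apply: le_trans (l1n_le x j.+1); rewrite /l1n big_ord_recr /= lerD2r.
apply: le_trans (l1n_mono x ij); rewrite /l1n big_ord_recr /= lerDr.
by apply: sumr_ge0 => k _; rewrite mulr_ge0 ?mag_ge0 ?(ltW (wt_gt0 _)).
Qed.

Lemma l2_unit_vec i : l2 (e_ i) <= 1.
Proof.
apply: le_trans (l2_fin _ _) _; rewrite /l2n sumsqS eqxx mag1 expr1n.
rewrite /sumsq big1 ?add0r ?sqrtr1 // => j _.
by rewrite ltn_eqF // mag0 expr0n.
Qed.

Lemma l1_unit_vec i : l1 (e_ i) <= wt i.
Proof.
apply: l1_le => m; have [mi|im] := leqP m i.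
  rewrite /l1n big1 ?(ltW (wt_gt0 _)) // => j _.
  by rewrite unit_vecE ltn_eqF ?mag0 ?mulr0 // (leq_trans _ mi).
rewrite /l1n (bigD1 (Ordinal im)) // unit_vecE eqxx mag1 mulr1.
rewrite big1 => [|j]; first by rewrite /= addr0.
rewrite -val_eqE => /negbTE ji.
by rewrite unit_vecE ji mag0 mulr0.
Qed.

Lemma mag_unit_vec i : (i <= 2)%N -> mag (e_ i) <= wt i.
Proof.
move=> i2; apply: mag_le_ell2; last exact: l1_unit_vec.
apply: le_trans (l2_unit_vec i) _.
rewrite -ler_pdivrMl // mulr1 lef_pV2 ?posrE ?exprn_gt0 //.
by rewrite -natrX ler_nat (leq_pexp2l _ i2).
Qed.

Lemma ropnorm_le_l1 f : (forall z, mag (f z : K) <= l1 z) -> ropnorm f <= 1.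
Proof.
move=> fl1; apply: ropnorm_leM => // z.
by rewrite mul1r (le_trans (fl1 z)) ?l1_le_mag.
Qed.

Lemma state_of_l1 f x : (forall z, mag (f z : K) <= l1 z) -> mag x <= 1 ->
  f x = 1 -> states (x, f).
Proof.
move=> /ropnorm_le_l1 f1 x1 fx; have : 1 <= ropnorm f * mag x.
  by rewrite -(@mag1 R K) -fx ropnorm_ge.
move=> h; apply/statesP; split=> //; apply/le_anti.
  by rewrite x1 (le_trans h) // ler_piMl ?mag_ge0.
by rewrite f1 (le_trans h) // ler_piMr ?ropnorm_ge0.
Qed.

Lemma ell2_states0 : @states K ell2 !=set0.
Proof.
exists (e_ 0, ell2_coord 0); apply: state_of_l1.
- by move=> z; rewrite ell2_coordE -[leLHS]mul1r -wt0 wt_coord_le_l1.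
- by rewrite -wt0 mag_unit_vec.
- by rewrite ell2_coordE unit_vecE.
Qed.

(** If phi_i are phases, the functional z |-> sum_(i < m) 2^-i phi_i z_i attains its
    norm at a multiple of e_j, whatever the phi_i with i different from j are. With
    the phases that align the coordinates of S e_j, its value at S e_j is the
    weighted partial sum. *)
Lemma l1_image_unit_vec (S : {bop ell2 -> ell2}) j : (j <= 2)%N ->
  rnumradius S <= 1 -> l1 (S (e_ j)) <= wt j.
Proof.
move=> j2 S1; set q := S (e_ j); apply: l1_le => m0.
pose m := maxn m0 j.+1; apply: le_trans (l1n_mono _ (leq_maxl m0 j.+1)) _.
rewrite -/m; pose phi i : K := (phase (q i : K))^-1.
pose h := fin_form m (fun i => emb (wt i) * phi i : K^o).
have hl1 z : mag (h z : K) <= l1 z.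
  apply: le_trans (l1n_le z m); apply: le_trans (mag_sum _ _ _) _.
  apply: ler_sum => i _.
  by rewrite !magM mag_phaseV mulr1 mag_pemb ?(ltW (wt_gt0 _)).
have hq : h q = emb (l1n m q).
  rewrite fin_formE rmorph_sum; apply: eq_bigr => i _.
  by rewrite -mulrA phaseVE -rmorphM.
have jm : (j < m)%N by exact: leq_maxr.
have he : h (e_ j) = emb (wt j) * phi j.
  rewrite fin_formE (bigD1 (Ordinal jm)) // unit_vecE eqxx mulr1.
  rewrite big1 => [|i]; first by rewrite /= addr0.
  rewrite -val_eqE => /negbTE ij.
  by rewrite unit_vecE ij mulr0.
have phi0 : phi j != 0 by rewrite invr_eq0 phase_neq0.
have := @rnumradius_ge_scaled _ _ _ ell2_states0 S ((phi j)^-1 *: e_ j) h (wt j).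
rewrite (bopZ S) -/q (functionalZ h _ q) hq magM mag_pemb; last first.
  by apply: sumr_ge0 => i _; rewrite mulr_ge0 ?mag_ge0 ?(ltW (wt_gt0 _)).
rewrite magV mag_phaseV invr1 mul1r => H; apply: le_trans (H _ _ _) _.
- exact: ropnorm_le_l1.
- by rewrite magZ magV mag_phaseV invr1 mul1r mag_unit_vec.
- by rewrite functionalZ he mulrCA mulVf // mulr1.
- by rewrite ler_piMl ?(ltW (wt_gt0 _)).
Qed.

(** The Euclidean part of the norm is inactive at y, hence also at y + w for a small
    multiple w of z turned so that f w >= 0. There 1 + f w is at most
    the weighted norm of y + w, hence at most 1 + |w|_w. *)
Lemma norming_le_l1 y f : mag y = 1 -> ropnorm f <= 1 -> f y = 1 -> l2 y <= 2 ->
  forall z, mag (f z : K) <= l1 z.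
Proof.
move=> y1 f1 fy y2 z.
pose t : R := (4 * (mag z + 1))^-1.
have z0 := mag_ge0 z.
have t0 : 0 < t by rewrite invr_gt0 mulr_gt0 // ltr_wpDl.
have tz : t * mag z <= 1 / 4.
  rewrite mulrC ler_pdivrMr ?mulr_gt0 ?ltr_wpDl // mulrA mul1r mulVf ?mul1r ?lerDl //.
pose w := (emb t * (phase (f z : K))^-1) *: z.
have fw : f (y + w) = emb (1 + t * mag (f z : K)).
  rewrite bopD fy functionalZ -mulrA phaseVE rmorphD rmorph1.
  by rewrite rmorphM.
have magw : mag w = t * mag z.
  by rewrite magZ magM mag_phaseV mulr1 mag_pemb ?(ltW t0).
have l1w : l1 w = t * l1 z.
  by rewrite l1Z magM mag_phaseV mulr1 mag_pemb ?(ltW t0).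
have fz0 := mag_ge0 (f z : K).
have tf0 : 0 <= t * mag (f z : K) by rewrite mulr_ge0 // ltW.
have : mag (f (y + w) : K) <= mag (y + w).
  by rewrite -[leRHS]mul1r ropnorm_ge_ball.
rewrite fw mag_pemb ?addr_ge0 //.
have l1y : l1 (y + w) <= 1 + t * l1 z.
  by apply: le_trans (l1D _ _) _; rewrite l1w lerD2r -y1 l1_le_mag.
have l2y : l2 (y + w) <= 3.
  have h := l2D y w; have := l2_le_mag w; rewrite magw.
  move: h y2 tz; clear.
  move: (l2 (y + w)) (l2 w) (l2 y) (t * _) => a b c d; lra.
rewrite mag_ell2 le_max => /orP[|/le_trans/(_ l1y)].
  by move: l2y tf0; clear; move: (l2 _) (t * _) => a b; lra.
by rewrite lerD2l ler_pM2l.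
Qed.

(** The main parts 1/2 * 1 and 1 * (-1/2) of the two products cancel. *)
Lemma scalar_cancellation (a b c d : K) :
  mag (a - 1) <= 1 / 4 -> mag (b + emb (1 / 2)) <= 1 / 8 ->
  mag (c - emb (1 / 2)) <= 1 / 16 -> mag (d - 1) <= 1 / 8 ->
  mag (c * a + d * b) < mag c * mag a + mag d * mag b.
Proof.
move=> a1 b1 c1 d1.
have -> : c * a + d * b = (c - emb (1 / 2)) * a + (d - 1) * b +
   (emb (1 / 2) * (a - 1) + (b + emb (1 / 2))) by ring.
have h1 : mag ((c - emb (1 / 2)) * a + (d - 1) * b +
   (emb (1 / 2) * (a - 1) + (b + emb (1 / 2)))) <=
   mag (c - emb (1 / 2)) * mag a + mag (d - 1) * mag b
   + (1 / 2 * mag (a - 1) + mag (b + emb (1 / 2))).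
  apply: le_trans (magD _ _) _; apply: lerD.
    by apply: le_trans (magD _ _) _; rewrite !magM.
  by apply: le_trans (magD _ _) _; rewrite magM mag_pemb // divr_ge0.
apply: le_lt_trans h1 _.
have a2 := magB_ge 1 (1 - a); rewrite subKr mag1 mag_distC in a2.
have b2 := magB_ge (emb (1 / 2)) (- b).
rewrite magN opprK mag_pemb ?divr_ge0 // addrC [emb _ + b]addrC in b2.
have c2 := magB_ge (emb (1 / 2)) c; rewrite mag_distC mag_pemb ?divr_ge0 // in c2.
have d2 := magB_ge 1 d; rewrite mag_distC mag1 in d2.
move: a1 b1 c1 d1 a2 b2 c2 d2.
have := mag_ge0 a; have := mag_ge0 b.
move: (mag a) (mag b) (mag c) (mag d) (mag (a - 1)) (mag (b + _))
  (mag (c - _)) (mag (d - 1)); clear.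
move=> A B C D A1 B1 C1 D1 A0 B0 h1 h2 h3 h4 h5 h6 h7 h8.
have : C1 * A <= 1 / 16 * A by rewrite ler_wpM2r.
have : D1 * B <= 1 / 8 * B by rewrite ler_wpM2r.
have : 7 / 16 * A <= C * A by rewrite ler_wpM2r //; lra.
have : 7 / 8 * B <= D * B by rewrite ler_wpM2r //; lra.
lra.
Qed.

End failure.

Section counterexample.
Context {R : realType} {K : scalars R}.
Local Notation emb := (emb K).
Local Notation ell2 := (@ell2 R K).
Local Notation e_ := (@unit_vec R K).
Implicit Types (n : nat) (x y z : ell2) (f g : {bop ell2 -> K^o}).

Lemma ler_sum_gap (F G : nat -> R) d m n : (n < m)%N ->
  (forall i, F i <= G i) -> d + F n <= G n ->
  d + \sum_(i < m) F i <= \sum_(i < m) G i.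
Proof.
move=> nm FG dFG; rewrite (bigD1 (Ordinal nm)) // [leRHS](bigD1 (Ordinal nm)) //=.
by rewrite addrA; apply: lerD => //; exact: ler_sum.
Qed.

Lemma l1nSS m (u : nat -> K^o) : l1n m.+2 u =
  mag (u 0%N : K) + (1 / 2 * mag (u 1%N : K) +
    \sum_(i < m) wt i.+2 * mag (u i.+2 : K)).
Proof. by rewrite /l1n !big_ord_recl /= wt0 wt1 (mul1r (mag _)). Qed.

Definition half_sum : {bop ell2 -> K^o} :=
  ell2_coord 0 + emb (1 / 2) *: ell2_coord 1.
Definition half_diff : {bop ell2 -> K^o} :=
  ell2_coord 0 - emb (1 / 2) *: ell2_coord 1.

Lemma half_sumE z : half_sum z = z 0%N + emb (1 / 2) * z 1%N.
Proof.
by rewrite -[LHS]/(ell2_coord 0 z + emb (1 / 2) * ell2_coord 1 z) !ell2_coordE.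
Qed.

Lemma half_diffE z : half_diff z = z 0%N - emb (1 / 2) * z 1%N.
Proof.
by rewrite -[LHS]/(ell2_coord 0 z - emb (1 / 2) * ell2_coord 1 z) !ell2_coordE.
Qed.

(** This operator sends e_0 and 2 e_1 to (1 - 2^-n) e_0 + e_n and
    (1 - 2^-n) e_0 - e_n, two vectors of norm 1. *)
Definition spread n : {bop ell2 -> ell2} :=
  rank1 half_sum (emb (1 - wt n) *: e_ 0) + rank1 half_diff (e_ n).

Lemma spreadE n z : spread n z =
  (half_sum z : K) *: (emb (1 - wt n) *: e_ 0) + (half_diff z : K) *: e_ n.
Proof. by []. Qed.

Lemma spread_image n z : spread n z =
  (z 0%N : K) *: (emb (1 - wt n) *: e_ 0 + e_ n) +
  (emb (1 / 2) * z 1%N) *: (emb (1 - wt n) *: e_ 0 - e_ n).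
Proof.
rewrite spreadE half_sumE half_diffE !scalerDl scalerDr scalerBr scaleNr.
by rewrite addrACA.
Qed.

Lemma mag_spread_dir n (s : K) : mag s = 1 ->
  mag (emb (1 - wt n) *: e_ 0 + s *: e_ n) <= 1.
Proof.
move=> s1; have w0 : 0 <= 1 - @wt R n by rewrite subr_ge0 wt_le1.
apply: mag_le_ell2.
  apply: le_trans (l2D _ _) _; rewrite !l2Z s1 mul1r mag_pemb //.
  have h0 := @l2_unit_vec R K 0; have hn := @l2_unit_vec R K n.
  have : (1 - wt n) * l2 (e_ 0) <= 1.
    rewrite -[leRHS]mul1r; apply: ler_pM => //; first exact: l2_ge0.
    by rewrite lerBlDr lerDl ltW ?wt_gt0.
  by move: hn; clear; move: (l2 _) (_ * _) => a b; lra.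
apply: le_trans (l1D _ _) _; rewrite !l1Z s1 mul1r mag_pemb //.
have h0 := @l1_unit_vec R K 0; have hn := @l1_unit_vec R K n.
rewrite wt0 in h0.
apply: le_trans (lerD (ler_wpM2l w0 h0) hn) _.
by rewrite mulr1 subrK.
Qed.

Lemma mag_spread n z : mag (spread n z) <= mag z.
Proof.
apply: le_trans (l1_le_mag z); apply: le_trans (two_coords_le_l1 z (ltnSn 0)).
rewrite wt0 wt1 spread_image !mul1r; apply: le_trans (magD _ _) _.
rewrite !magZ ?magM mag_pemb ?divr_ge0 //; apply: lerD.
  rewrite ler_piMr ?mag_ge0 // -[e_ n]scale1r mag_spread_dir //; exact: mag1.
rewrite ler_piMr ?mulr_ge0 ?mag_ge0 // -(scaleN1r (e_ n)) mag_spread_dir //.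
by rewrite magN mag1.
Qed.

Lemma spread_unit0 n : spread n (e_ 0) = emb (1 - wt n) *: e_ 0 + e_ n.
Proof.
by rewrite spread_image !unit_vecE mulr0 scale0r addr0 scale1r.
Qed.

(** The value 1 is taken at the state (e_0, z |-> z_0 + 2^-n z_n). *)
Lemma rnumradius_spread n : (2 <= n)%N -> rnumradius (spread n) = 1.
Proof.
move=> n2; have n0 : (n == 0)%N = false by rewrite gtn_eqF // (leq_trans _ n2).
have X0 := @ell2_states0 R K; apply/le_anti/andP; split.
  apply: rnumradius_le => // z f /statesP[z1 f1 _].
  by rewrite (le_trans (ropnorm_ge f _)) // f1 mul1r -z1 mag_spread.
pose g : {bop ell2 -> K^o} := ell2_coord 0 + emb (wt n) *: ell2_coord n.
have gE z : g z = z 0%N + emb (wt n) * z n.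
  by rewrite -[LHS]/(ell2_coord 0 z + emb (wt n) * ell2_coord n z) !ell2_coordE.
have w0 := ltW (@wt_gt0 R n).
have gs : states (e_ 0, g).
  apply: state_of_l1.
  - move=> z; rewrite gE; apply: le_trans (magD _ _) _; rewrite magM mag_pemb //.
    by rewrite -[X in X + _]mul1r -wt0 two_coords_le_l1 // (leq_trans _ n2).
  - by rewrite -wt0 mag_unit_vec.
  - by rewrite gE !unit_vecE n0 mulr0 addr0.
have := rnumradius_ge X0 (spread n) gs; rewrite spread_unit0 gE.
rewrite !ell2D_E !ell2Z_E !unit_vecE !eqxx eq_sym n0 !mulr0 !mulr1.
by rewrite addr0 add0r mulr1 -rmorphD subrK rmorph1 mag1.
Qed.

Definition midpoint : ell2 := emb (1 / 2) *: e_ 0 + e_ 1.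

Lemma midpointE i : midpoint i = emb (1 / 2) * (i == 0)%:R + (i == 1)%:R.
Proof. by rewrite ell2D_E ell2Z_E !unit_vecE. Qed.

Lemma l2_midpoint : l2 midpoint <= 3 / 2.
Proof.
apply: le_trans (l2D _ _) _; rewrite l2Z mag_pemb ?divr_ge0 //.
have := @l2_unit_vec R K 0; have := @l2_unit_vec R K 1; clear.
by move: (l2 _) (l2 _) => a b; lra.
Qed.

Lemma states_midpoint : states (midpoint, half_sum).
Proof.
have h : emb (1 / 2) + emb (1 / 2) = 1 by rewrite -rmorphD -splitr rmorph1.
apply: state_of_l1.
- move=> z; rewrite half_sumE; apply: le_trans (magD _ _) _.
  rewrite magM mag_pemb ?divr_ge0 //.
  by have := two_coords_le_l1 z (ltnSn 0); rewrite wt0 wt1 (mul1r (mag _)).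
- apply: mag_le_ell2.
    by apply: le_trans l2_midpoint _; lra.
  apply: le_trans (l1D _ _) _; rewrite l1Z mag_pemb ?divr_ge0 //.
  have := @l1_unit_vec R K 0; have := @l1_unit_vec R K 1; rewrite wt0 wt1; clear.
  by move: (l1 _) (l1 _) => a b; lra.
- by rewrite half_sumE !midpointE /= !mulr0 !mulr1 addr0 add0r mulr1.
Qed.

Lemma half_sum_spread_midpoint n :
  half_sum (spread n midpoint) = emb (1 - wt n).
Proof.
have h : emb (1 / 2) + emb (1 / 2) = 1 by rewrite -rmorphD -splitr rmorph1.
have m0 : midpoint 0 = emb (1 / 2) by rewrite midpointE /= mulr1 addr0.
have m1 : midpoint 1 = 1 by rewrite midpointE /= mulr0 add0r.
have -> : spread n midpoint = emb (1 - wt n) *: e_ 0.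
  rewrite spreadE half_sumE half_diffE m0 m1 mulr1 h subrr.
  by rewrite scale0r addr0 scale1r.
rewrite half_sumE !ell2Z_E !unit_vecE.
by rewrite (_ : (0 == 0)%N = true) // (_ : (1 == 0)%N = false) // !mulr0 addr0 mulr1.
Qed.

(** Write y = (1/4) g + r with g = y_0 e_0 + y_1 e_1. The weighted norms of the two
    pieces add up to that of y, so f is extremal at r, and r / |r| carries a state:
    |f (S r)| <= |r|. Hence f (S g) takes its largest possible value, which forces
    equality in the triangle inequality for S g, against the cancellation in the
    coordinate n. *)
Lemma no_state_near_midpoint n (S : {bop ell2 -> ell2}) y f : (2 <= n)%N ->
  states (y, f) -> rnumradius S <= 1 -> 1 <= mag (f (S y) : K) ->
  ropnorm (spread n - S) <= 1 / 16 -> mag (midpoint - y) <= 1 / 16 -> False.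
Proof.
move=> n2 /statesP[ymag f1 fy] S1 fSy TS xy.
have n0 : (n == 0)%N = false by rewrite gtn_eqF // (leq_trans _ n2).
have X0 := @ell2_states0 R K.
have y2 : l2 y <= 7 / 4.
  have yE : y = midpoint + (y - midpoint) by rewrite addrC subrK.
  rewrite [leLHS](congr1 l2 yE); apply: le_trans (l2D _ _) _.
  have := l2_le_mag (y - midpoint); rewrite (mag_distC y).
  move: l2_midpoint xy; clear.
  by move: (l2 _) (l2 _) (mag _) => a b c; lra.
have fl1 : forall z, mag (f z : K) <= l1 z.
  apply: (norming_le_l1 ymag) => //; first by rewrite f1.
  by apply: le_trans y2 _; lra.
have xy0 : mag (y 0%N - emb (1 / 2) : K) <= 1 / 16.
  have := wt_coord_le_l1 (midpoint - y) 0; rewrite wt0 mul1r ell2B_E midpointE.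
  rewrite /= mulr1 addr0 mag_distC => /le_trans; apply.
  exact: le_trans (l1_le_mag _) xy.
have xy1 : mag (y 1%N - 1 : K) <= 1 / 8.
  have := wt_coord_le_l1 (midpoint - y) 1; rewrite wt1 ell2B_E midpointE.
  rewrite /= mulr0 add0r mag_distC => h; have := le_trans h (le_trans (l1_le_mag _) xy).
  by clear; move: (mag _) => a; lra.
have w0 := @wt_gt0 R n.
pose Y0 := mag (y 0%N : K); pose Y1 := mag (y 1%N : K).
have Y0b : 0 <= Y0 <= 9 / 16.
  rewrite mag_ge0 /=; have := magB_ge (y 0%N : K) (emb (1 / 2)).
  rewrite mag_pemb ?divr_ge0 // -/Y0; move: xy0; clear.
  by move: Y0 (mag _) => a b; lra.
have Y1b : 0 <= Y1 <= 9 / 8.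
  rewrite mag_ge0 /=; have := magB_ge (y 1%N : K) 1.
  rewrite mag1 -/Y1; move: xy1; clear.
  by move: Y1 (mag _) => a b; lra.
pose g : ell2 := (y 0%N : K) *: e_ 0 + (y 1%N : K) *: e_ 1.
(* Only a quarter of g is removed, so that the Euclidean part of the norm
   remains inactive at r. *)
pose r : ell2 := y - emb (1 / 4) *: g.
pose sigma := Y0 + Y1 / 2.
have sigma_b : 0 <= sigma <= 9 / 8.
  by rewrite /sigma; move: Y0b Y1b; clear; move: Y0 Y1 => a b; lra.
have gE i : g i = y 0%N * (i == 0)%:R + y 1%N * (i == 1)%:R.
  by rewrite ell2D_E !ell2Z_E !unit_vecE.
have l1g : l1 g <= sigma.
  apply: le_trans (l1D _ _) _; rewrite !l1Z -/Y0 -/Y1.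
  have := @l1_unit_vec R K 0; have := @l1_unit_vec R K 1; rewrite wt0 wt1.
  move=> h1 h0; apply: lerD; rewrite ?ler_piMr ?mag_ge0 //.
  by rewrite ler_wpM2l ?mag_ge0 // -div1r.
have l1r : l1 r <= 1 - sigma / 4.
  apply: l1_le => m; apply: le_trans (l1n_mono _ (leq_addr 2 m)) _.
  suff -> : l1n (m + 2) r = l1n (m + 2) y - sigma / 4.
    by rewrite lerD2r (le_trans (l1n_le y _)) // -ymag l1_le_mag.
  rewrite addn2 !l1nSS.
  have ri i : r i.+2 = y i.+2.
    by rewrite ell2B_E ell2Z_E gE /= !mulr0 addr0 mulr0 subr0.
  rewrite (eq_bigr (fun i : 'I_m => wt i.+2 * mag (y i.+2 : K))); last first.
    by move=> i _; rewrite ri.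
  have r0 : r 0%N = emb (3 / 4) * y 0%N.
    rewrite ell2B_E ell2Z_E gE /= mulr0 addr0 mulr1 -[X in X - _]mul1r -mulrBl.
    by rewrite -(rmorph1 emb) -rmorphB; congr (emb _ * _); lra.
  have r1 : r 1%N = emb (3 / 4) * y 1%N.
    rewrite ell2B_E ell2Z_E gE /= mulr0 add0r mulr1 -[X in X - _]mul1r -mulrBl.
    by rewrite -(rmorph1 emb) -rmorphB; congr (emb _ * _); lra.
  rewrite r0 r1 !magM mag_pemb ?divr_ge0 // -/Y0 -/Y1 /sigma.
  by clear; move: Y0 Y1 (\sum_(_ < _) _) => a b c; lra.
have fr : f r = emb (1 - sigma / 4).
  have sum1 : emb (1 / 4) * f g + f r = 1 :> K.
    by rewrite bopB functionalZ addrC subrK fy.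
  have fgle : mag (emb (1 / 4) * f g : K) <= sigma / 4.
    rewrite magM mag_pemb ?divr_ge0 //.
    have := le_trans (fl1 g) l1g; clear; move: (mag _) sigma => a b; lra.
  have frle := le_trans (fl1 r) l1r.
  have sigma1 : sigma / 4 + (1 - sigma / 4) = 1 by rewrite addrC subrK.
  apply: (add_emb_extremal frle fgle).
  by rewrite addrC sum1 [_ + sigma / 4]addrC sigma1 rmorph1.
have magr : mag r <= 1 - sigma / 4.
  apply: mag_le_ell2 => //; apply: le_trans (l2D _ _) _.
  rewrite -scaleN1r !l2Z magN mag1 mul1r mag_pemb ?divr_ge0 //.
  have := l2D ((y 0%N : K) *: e_ 0) ((y 1%N : K) *: e_ 1).
  rewrite -/g !l2Z -/Y0 -/Y1.
  have h0 : Y0 * l2 (e_ 0) <= Y0 by rewrite ler_piMr ?l2_unit_vec ?mag_ge0.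
  have h1 : Y1 * l2 (e_ 1) <= Y1 by rewrite ler_piMr ?l2_unit_vec ?mag_ge0.
  move: y2 h0 h1 Y0b Y1b; rewrite /sigma; clear.
  by move: Y0 Y1 (l2 y) (l2 g) (Y0 * l2 _) (Y1 * l2 _) => A B a b c d; lra.
have fSr : mag (f (S r) : K) <= 1 - sigma / 4.
  have := rnumradius_ge_scaled X0 S (_ : ropnorm f <= 1) magr fr; rewrite f1 => /(_ (lexx 1)).
  move=> /le_trans; apply; rewrite ler_piMl //.
  by move: sigma_b; clear; move: sigma => a; lra.
have fSg : sigma <= mag (f (S g) : K).
  have yE : y = emb (1 / 4) *: g + r by rewrite addrC subrK.
  have fSyE : f (S y) = emb (1 / 4) * f (S g) + f (S r).
    by rewrite -functionalZ -bopZ -bopD -bopD -yE.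
  move: fSy; rewrite fSyE.
  move=> /le_trans/(_ (magD _ _)); rewrite magM mag_pemb ?divr_ge0 //.
  by move: fSr; clear; move: (mag _) (mag _) sigma => a b c; lra.
pose q0 := S (e_ 0); pose q1 := S (e_ 1).
have SgE : S g = (y 0%N : K) *: q0 + (y 1%N : K) *: q1 by rewrite bopD !bopZ.
have l1q0 : l1 q0 <= 1 by rewrite -wt0 l1_image_unit_vec.
have l1q1 : l1 q1 <= 1 / 2 by rewrite -wt1 l1_image_unit_vec.
have Tn i : spread n (e_ i) n = half_diff (e_ i).
  by rewrite spreadE ell2D_E !ell2Z_E !unit_vecE n0 eqxx !mulr0 add0r mulr1.
have coord_close i : (i <= 2)%N ->
    mag (S (e_ i) n - half_diff (e_ i) : K) <= wt i / 4.
  move=> i2; rewrite -Tn -[X in mag X](_ : (S (e_ i) - spread n (e_ i)) n = _) //.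
  apply: le_trans (mag_coord _ _) _; rewrite mag_distC.
  have := ropnorm_ge_ball (e_ i) TS (divr_ge0 ler01 (ler0n _ 16)).
  rewrite -[(spread n - S) (e_ i)]/(spread n (e_ i) - S (e_ i)) => h.
  have := @mag_unit_vec R K i i2; move: h; clear.
  by move: (mag _) (mag _) (wt i) => a b c; lra.
have q0n : mag (q0 n - 1 : K) <= 1 / 4.
  by have := coord_close 0 isT; rewrite half_diffE !unit_vecE mulr0 subr0 wt0.
have q1n : mag (q1 n + emb (1 / 2) : K) <= 1 / 8.
  have := coord_close 1 isT; rewrite half_diffE !unit_vecE mulr1 sub0r opprK wt1.
  by move/le_trans; apply; lra.
(* The loss at the coordinate n in the triangle inequality for S g. *)
have gap := scalar_cancellation q0n q1n xy0 xy1.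
have : l1 (S g) <= sigma - wt n * (Y0 * mag (q0 n : K) + Y1 * mag (q1 n : K)
    - mag (y 0%N * q0 n + y 1%N * q1 n : K)).
  apply: l1_le => m; apply: le_trans (l1n_mono _ (leq_maxl m n.+1)) _.
  rewrite lerBrDl.
  have nm : (n < maxn m n.+1)%N by exact: leq_maxr.
  move: (maxn _ _) nm => {}m nm.
  apply: le_trans (_ : Y0 * l1n m q0 + Y1 * l1n m q1 <= _); last first.
    apply: lerD; rewrite ?ler_piMr ?mag_ge0 ?(le_trans (l1n_le _ _)) //.
    by rewrite ler_wpM2l ?mag_ge0 // -div1r (le_trans (l1n_le _ _)).
  rewrite [leRHS](_ : _ = \sum_(i < m)
      wt i * (Y0 * mag (q0 i : K) + Y1 * mag (q1 i : K))); last first.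
    rewrite /l1n !mulr_sumr -big_split; apply: eq_bigr => i _.
    by rewrite mulrDr !(mulrCA (wt i)).
  have Sgi i : S g i = y 0%N * q0 i + y 1%N * q1 i.
    by rewrite SgE ell2D_E !ell2Z_E.
  apply: (ler_sum_gap (F := fun i => wt i * mag (S g i : K))
    (G := fun i => wt i * (Y0 * mag (q0 i : K) + Y1 * mag (q1 i : K))) nm).
    move=> i; rewrite ler_wpM2l ?(ltW (wt_gt0 _)) // Sgi.
    by rewrite (le_trans (magD _ _)) // !magM.
  by rewrite Sgi -mulrDr subrK.
move=> h; have := le_trans fSg (le_trans (fl1 (S g)) h).
have : 0 < wt n * (Y0 * mag (q0 n : K) + Y1 * mag (q1 n : K)
    - mag (y 0%N * q0 n + y 1%N * q1 n : K)) by rewrite mulr_gt0 // subr_gt0.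
by clear; move: (_ * _) sigma => a b; lra.
Qed.

(** The tolerance 1/16 fails for every eta, with n such that 2^-n < eta. *)
Theorem ell2_not_BPBp : ~ BPBp_nu (@ell2_space R K).
Proof.
have X0 := @ell2_states0 R K.
move=> /(_ (emb (1 / 16))) [|eta eta0 H].
  by rewrite -(rmorph0 emb) -(rmorph1 emb) !ltr_emb; apply/andP; split; lra.
have [d _ etaE] := ge0_emb (ltW eta0).
have d0 : 0 < d by move: eta0; rewrite etaE -(rmorph0 emb) ltr_emb.
pose n := (Num.truncn d^-1).+2.
have n_d : @wt R n < d.
  rewrite /wt -[ltRHS]invrK ltf_pV2 ?posrE ?invr_gt0 ?exprn_gt0 //.
  apply: lt_trans (truncnS_gt _) _; rewrite -natrX ltr_nat.
  by rewrite (leq_trans _ (ltnW (ltn_expl n _))).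
have [||S [y [f [yf [SE S1] TS xy _]]]] :=
  H (spread n) midpoint half_sum (states_midpoint).
- by rewrite numradiusE // rnumradius_spread // rmorph1.
- rewrite half_sum_spread_midpoint magE mag_emb etaE -(rmorph1 emb) -rmorphB ltr_emb.
  by rewrite ger0_norm ?subr_ge0 ?wt_le1 // ltrD2l ltrN2.
apply: (@no_state_near_midpoint n S y f isT yf).
- by rewrite -(@ler_emb R K) -numradiusE // SE S1 rmorph1.
- by rewrite /mag S1 -(rmorph1 emb) embK.
- by move: TS; rewrite opnormE ltr_emb => /ltW.
- by move: xy; rewrite lt_mag => /ltW.
Qed.

End counterexample.

(** * The real and the complex scalars *)

Section scalar_fields.
Variable R : realType.

Lemma real_ultralimit (T : Type) (U : set_system T) (u : T -> R) (M : R) :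
  UltraFilter U -> U [set t | `|u t| <= M] ->
  exists l, forall e : R, 0 < e -> U [set t | `|u t - l| < e].
Proof.
move=> UU UM; have UF : ProperFilter U by exact: ultra_proper.
have UuM : U (u @^-1` `[- M, M]%classic).
  by apply: filterS UM => t; rewrite /= in_itv /= -ler_norml.
have [l [_ ul]] := @segment_compact R (- M) M (u @ U) _ UuM.
exists l => e e0; have [//|Ue] := in_ultra_setVsetC [set t | `|u t - l| < e] UU.
have [_ [[t /= te <-]]] := ul (u @` [set t | ~ `|u t - l| < e]) (ball l e)
  (filterS (fun t h => ex_intro2 _ _ t h erefl) Ue) (nbhsx_ballx _ _ e0).
by rewrite -ball_normE /= distrC.
Qed.

Let re_id : {additive R -> R} := idfun.
Let emb_id : {rmorphism R -> R} := idfun.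

Definition real_scalars : scalars R.
Proof.
refine (@Scalars R R emb_id re_id _ _ _ _ _ _) => //.
- by move=> z z0; exists z.
- exact: ler_norm.
- exact: real_ultralimit.
Defined.

Local Open Scope complex_scope.

Lemma complex_Re_additive : zmod_morphism (@complex.Re R).
Proof. by move=> [a b] [c d]. Qed.

HB.instance Definition _ :=
  GRing.isZmodMorphism.Build R[i] R (@complex.Re R) complex_Re_additive.

Definition complex_scalars : scalars R.
Proof.
refine (@Scalars R R[i] (real_complex R) (@complex.Re R) _ _ _ _ _ _) => //.
- by move=> r r0; rewrite lecE /= eqxx.
- by move=> [a b]; rewrite lecE /= => /andP[/eqP -> a0]; exists a.
- move=> [a b]; rewrite normc_def /=.
  by rewrite (le_trans (ler_norm a)) // -sqrtr_sqr ler_wsqrtr // lerDl sqr_ge0.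
- move=> [a b]; rewrite normc_def /= => aE.
  have a0 : 0 <= a by rewrite aE sqrtr_ge0.
  have : a ^+ 2 = a ^+ 2 + b ^+ 2 by rewrite {1}aE sqr_sqrtr ?addr_ge0 ?sqr_ge0.
  move=> /eqP; rewrite -subr_eq0 opprD addrA subrr sub0r oppr_eq0 sqrf_eq0.
  by move=> /eqP b0; rewrite -aE b0.
- move=> T U u M UU UM; have UF : ProperFilter U by exact: ultra_proper.
  have normE (z : R[i]) : complex.Re `|z| =
      Num.sqrt (complex.Re z ^+ 2 + complex.Im z ^+ 2) by rewrite normc_def.
  have {}UM : U [set t | complex.Re `|u t| <= M] := UM.
  have [|a aU] := @real_ultralimit T U (fun t => complex.Re (u t)) M UU.
    apply: filterS UM => t; rewrite /mkset normE; apply: le_trans.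
    by rewrite -sqrtr_sqr ler_wsqrtr // lerDl sqr_ge0.
  have [|b bU] := @real_ultralimit T U (fun t => complex.Im (u t)) M UU.
    apply: filterS UM => t; rewrite /mkset normE; apply: le_trans.
    by rewrite -sqrtr_sqr ler_wsqrtr // lerDr sqr_ge0.
  exists (Complex a b) => e e0; have e20 : 0 < e / 2 by rewrite divr_gt0.
  apply: filterS (filterI (aU _ e20) (bU _ e20)) => t [/= ha hb].
  rewrite -[X in is_true (X < _)]/(complex.Re `|u t - Complex a b|) normE.
  case: (u t) ha hb => p q /= ha hb.
  have S0 : 0 <= `|p - a| + `|q - b| by rewrite addr_ge0.
  apply: le_lt_trans (_ : `|p - a| + `|q - b| < e).
    rewrite -[leRHS]ger0_norm // -[leRHS]sqrtr_sqr ler_wsqrtr //.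
    rewrite -(real_normK (num_real (p - a))) -(real_normK (num_real (q - b))).
    by rewrite sqrrD -addrA lerD2l lerDr mulrn_wge0 // mulr_ge0.
  by rewrite [ltRHS](splitr e) ltrD.
Defined.

End scalar_fields.

Lemma reflexive_not_BPBp_nu (R : realType) (K : scalars R) :
  exists X : completeNormedModType K,
     [/\ reflexive_space X, numradius_attaining_dense X & ~ BPBp_nu X].
Proof.
exists (@ell2_space R K); split.
- exact: ell2_reflexive.
- apply: reflexive_numradius_dense.
  + exact: ell2_reflexive.
  + exact: ell2_states0.
  + exact: ell2_norming.
- exact: ell2_not_BPBp.
Qed.

Theorem mainTheorem3 (R : realType) :
  (exists X : completeNormedModType R,
     [/\ reflexive_space X, numradius_attaining_dense X & ~ BPBp_nu X]) /\
  (exists X : completeNormedModType R[i],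
     [/\ reflexive_space X, numradius_attaining_dense X & ~ BPBp_nu X]).
Proof.
split; first exact: (reflexive_not_BPBp_nu (real_scalars R)).
exact: (reflexive_not_BPBp_nu (complex_scalars R)).
Qed.
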